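(* For all finite integers $n,k\ge1$, the variety $$\mathsf V(S_c^*(a^n))\vee\mathsf V(S_c^*(a_1\cdots a_k))$$ is finitely based if and only if $k\le2$ or $n\ge2k-1$. If $n\ge2k-1$, this join equals $\mathsf V(S_c^*(a^n))$.
   Context: An ai-semiring (additively idempotent semiring) is an algebra $(S,+,\cdot)$ with two binary operations such that $(S,+)$ is a commutative idempotent semigroup, $(S,\cdot)$ is a semigroup, and both distributive laws hold. The signature is $(+,\cdot)$, with no constants. $\mathsf V(S)$ denotes the variety generated by $S$, and $\vee$ is the join in the lattice of varieties. A variety is finitely based if its identities all follow from a finite set of them; otherwise it is nonfinitely based. For $n\ge 1$, $S_c^*(a^n)$ is the ai-semiring with universe $\{a,a^2,\ldots,a^n,0\}$ ($n+1$ distinct elements), where $0$ is absorbing for both addition and multiplication, $a^i+a^j=a^{\max\{i,j\}}$, and $a^i a^j=a^{i+j}$ if $i+j\le n$, $a^ia^j=0$ if $i+j>n$. For $k\ge1$ and distinct letters $a_1,\dots,a_k$, the semiring $S_c^*(a_1\cdots a_k)$ has as its nonzero elements all nonempty square-free commutative words on $\{a_1,\ldots,a_k\}$, together with an element $0$ absorbing for both addition and multiplication. For nonzero $u,v$: $u+v$ is the square-free word whose set of letters is the union of the sets of letters of $u$ and $v$; $u\cdot v$ is the square-free word $uv$ if $u$ and $v$ have no letter in common, and $u\cdot v=0$ otherwise. *)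

(* Defs.v *)
From Stdlib Require List.
From mathcomp Require Import all_boot.

Set Implicit Arguments.
Unset Strict Implicit.
Unset Printing Implicit Defensive.

Record algebra := Algebra {
  carrier :> Type;
  add : carrier -> carrier -> carrier;
  mul : carrier -> carrier -> carrier
}.

Definition is_ai_semiring (A : algebra) : Prop :=
  [/\ associative (@add A), commutative (@add A) & idempotent_op (@add A)] /\
  [/\ associative (@mul A), left_distributive (@mul A) (@add A)
    & right_distributive (@mul A) (@add A)].

Inductive term :=
  | Var of nat
  | Add of term & term
  | Mul of term & term.

Definition identity := (term * term)%type.

Fixpoint eval (A : algebra) (v : nat -> A) (t : term) : A :=
  match t with
  | Var i => v i
  | Add t1 t2 => add (eval v t1) (eval v t2)
  | Mul t1 t2 => mul (eval v t1) (eval v t2)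
  end.

Definition satisfies (A : algebra) (e : identity) : Prop :=
  forall v : nat -> A, eval v e.1 = eval v e.2.

Definition hom (A B : algebra) (f : A -> B) : Prop :=
  (forall x y, f (add x y) = add (f x) (f y)) /\
  (forall x y, f (mul x y) = mul (f x) (f y)).

Definition prod_algebra (I : Type) (F : I -> algebra) : algebra :=
  {| carrier := forall i, F i;
     add := fun x y i => add (x i) (y i);
     mul := fun x y i => mul (x i) (y i) |}.

Definition class := algebra -> Prop.

Definition hom_image_closed (K : class) : Prop :=
  forall (A B : algebra) (f : A -> B),
    hom f -> (forall y, exists x, f x = y) -> K A -> K B.

(* Subalgebras are taken up to isomorphism, as domains of embeddings; as usual
   in universal algebra they have to be nonempty. *)
Definition subalgebra_closed (K : class) : Prop :=
  forall (A B : algebra) (f : B -> A),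
    inhabited B -> hom f -> injective f -> K A -> K B.

Definition product_closed (K : class) : Prop :=
  forall (I : Type) (F : I -> algebra),
    (forall i, K (F i)) -> K (prod_algebra F).

Definition variety (K : class) : Prop :=
  [/\ hom_image_closed K, subalgebra_closed K & product_closed K].

Definition subclass (K L : class) : Prop := forall A, K A -> L A.

Definition same_class (K L : class) : Prop := forall A, K A <-> L A.

Definition generated_variety (S : algebra) : class :=
  fun A => forall K : class, variety K -> K S -> K A.

Definition variety_join (V W : class) : class :=
  fun A => forall K : class, variety K -> subclass V K -> subclass W K -> K A.

Definition holds_in (K : class) (e : identity) : Prop :=
  forall A, K A -> satisfies A e.

Definition follows_from (s : seq identity) (e : identity) : Prop :=
  forall A : algebra, (forall d, List.In d s -> satisfies A d) -> satisfies A e.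

Definition finitely_based (K : class) : Prop :=
  exists s : seq identity,
    (forall e, List.In e s -> holds_in K e) /\
    (forall e, holds_in K e -> follows_from s e).

(* [Some i] stands for a^(i+1) and [None] for 0. *)
Definition power_add n (x y : option 'I_n) : option 'I_n :=
  match x, y with
  | Some i, Some j => Some (if i <= j then j else i)
  | _, _ => None
  end.

(* a^(i+1) a^(j+1) = a^((i+j+1)+1); [insub] returns [None] when i+j+1 >= n,
   i.e. when the exponent i+j+2 exceeds n. *)
Definition power_mul n (x y : option 'I_n) : option 'I_n :=
  match x, y with
  | Some i, Some j => insub (i + j).+1
  | _, _ => None
  end.

(* S_c^*(a^n) *)
Definition Sc_power (n : nat) : algebra :=
  {| carrier := option 'I_n; add := @power_add n; mul := @power_mul n |}.

(* A nonempty square-free commutative word is given by its set of letters. *)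
Definition word (k : nat) := {A : {set 'I_k} | A != set0}.

Lemma word_union_neq0 k (u v : word k) : val u :|: val v != set0.
Proof. by rewrite setU_eq0 negb_and (valP u). Qed.

Definition word_union k (u v : word k) : word k :=
  exist _ (val u :|: val v) (word_union_neq0 u v).

(* [None] stands for 0. *)
Definition word_add k (x y : option (word k)) : option (word k) :=
  match x, y with
  | Some u, Some v => Some (word_union u v)
  | _, _ => None
  end.

Definition word_mul k (x y : option (word k)) : option (word k) :=
  match x, y with
  | Some u, Some v =>
      if [disjoint val u & val v] then Some (word_union u v) else None
  | _, _ => None
  end.

(* S_c^*(a_1 ... a_k) *)
Definition Sc_word (k : nat) : algebra :=
  {| carrier := option (word k); add := @word_add k; mul := @word_mul k |}.

Lemma Sc_power_ai_semiring n : is_ai_semiring (Sc_power n).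
Proof.
have addC : commutative (@power_add n).
  move=> [i|] [j|] //=; congr Some; apply: val_inj.
  by case: (ltngtP i j).
have mulC : commutative (@power_mul n).
  by move=> [i|] [j|] //=; rewrite addnC.
have valD (i j : 'I_n) : val (if i <= j then j else i) = maxn i j.
  by case: leqP.
have mulD : left_distributive (@power_mul n) (@power_add n).
  move=> [i|] [j|] [m|] //=; try by case: insubP.
  have [le_ij|lt_ji] := leqP i j.
    case: (insubP _ (j + m).+1) => [u _ vu|_]; last by case: insubP.
    have lt_im : (i + m).+1 < n.
      by rewrite (leq_ltn_trans _ (ltn_ord u)) // vu ltnS leq_add2r.
    rewrite (insubT (fun x => x < n) lt_im) /=; congr Some; apply: val_inj.
    by rewrite /= vu ltnS leq_add2r le_ij.
  case: (insubP _ (i + m).+1) => [u _ vu|_] //.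
  have lt_jm : (j + m).+1 < n.
    by rewrite (leq_ltn_trans _ (ltn_ord u)) // vu ltnS leq_add2r ltnW.
  rewrite (insubT (fun x => x < n) lt_jm) /=; congr Some; apply: val_inj.
  by rewrite /= vu ltnS leq_add2r leqNgt lt_ji.
split; split=> //=.
- move=> [i|] [j|] [m|] //=; congr Some; apply: val_inj.
  by rewrite !valD /= maxnA.
- by move=> [i|] //=; rewrite leqnn.
- move=> [i|] [j|] [m|] //=; try by case: insubP.
  case: (insubP _ (j + m).+1) => [u _ vu|]; case: (insubP _ (i + j).+1) => //.
  + by move=> w _ vw /=; rewrite vu vw addnS addSn addnA.
  + move=> ge_n /=; rewrite insubN // vu; apply: contra ge_n.
    by apply: leq_ltn_trans; rewrite ltnS addnS addnA leqW ?leq_addr.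
  + move=> w _ vw ge_n /=; rewrite insubN // vw; apply: contra ge_n.
    by apply: leq_ltn_trans; rewrite ltnS addSn -addnA leqW ?leq_addl.
- by move=> x y z; rewrite !(mulC x) mulD.
Qed.

Lemma Sc_word_ai_semiring k : is_ai_semiring (Sc_word k).
Proof.
have addC : commutative (@word_add k).
  by move=> [u|] [v|] //=; congr Some; apply: val_inj; rewrite /= setUC.
have mulC : commutative (@word_mul k).
  move=> [u|] [v|] //=; rewrite disjoint_sym; case: ifP => // _.
  by congr Some; apply: val_inj; rewrite /= setUC.
have disjU (A B C : {set 'I_k}) :
    [disjoint A :|: B & C] = [disjoint A & C] && [disjoint B & C].
  by rewrite -!setI_eq0 setIUl setU_eq0.
have disjUr (A B C : {set 'I_k}) :
    [disjoint A & B :|: C] = [disjoint A & B] && [disjoint A & C].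
  by rewrite -!setI_eq0 setIUr setU_eq0.
have mulD : left_distributive (@word_mul k) (@word_add k).
  move=> [u|] [v|] [w|] //=; try by case: ifP.
  rewrite disjU.
  case: [disjoint val u & val w]; case: [disjoint val v & val w] => //=.
  by congr Some; apply: val_inj; rewrite /= setUACA setUid.
split; split=> //=.
- move=> [u|] [v|] [w|] //=; congr Some; apply: val_inj.
  by rewrite /= setUA.
- by move=> [u|] //=; congr Some; apply: val_inj; rewrite /= setUid.
- move=> [u|] [v|] [w|] //=; try by case: ifP.
  case vw: [disjoint val v & val w]; case uv: [disjoint val u & val v] => //=.
  + rewrite disjU disjUr uv vw andbT /=; case: ifP => //= _.
    by congr Some; apply: val_inj; rewrite /= setUA.
  + by rewrite disjUr uv.
  + by rewrite disjU vw andbF.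
- by move=> x y z; rewrite !(mulC x) mulD.
Qed.

(* Main.v *)
From mathcomp Require Import all_boot.
From mathcomp Require Import perm boolp.
From mathcomp Require Import zify.
Require Import Defs.

(* Commutative monomials are words in the variables, and a term is the sum of its
   monomials. In S_c^*(a^n) a term takes its maximal weight, truncated at n+1;
   in S_c^*(a_1...a_k) a term is nonzero exactly when letting variables in a common
   monomial be adjacent gives a loopless graph that the valuation colours properly,
   so the identities speak about k-colourings.

   If n >= 2k-1, the set of letters A can be read off from weights in which the
   letters of A are heavier than n-k, whence S_c^*(a_1...a_k) lies in the variety of
   S_c^*(a^n). For the latter, an inequality q <= u between a monomial and a term
   involves only the weights of the variables of q (the other ones may be taken to
   be 1), so boundedly many monomials of u suffice to imply it. For k = 2 and n <= 2
   graph walks give an explicit basis.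

   If k >= 3 and n <= 2k-2, let G be a graph that is not k-colourable but whose
   small subgraphs are bipartite (a shift graph), and let u be the sum of its edges
   and of a monomial q_0...q_(k-1) in new letters. Then u = u + q_0^2 holds in
   both semirings. It fails in the analogue of S_c^*(a_1...a_k) over the disjoint
   union of G and the complete graph on the q_i, although this algebra satisfies all
   identities of S_c^*(a_1...a_k) in few variables, because three colours allow any two
   nonadjacent vertices of a small subgraph to be coloured alike. *)

Set Implicit Arguments.
Unset Strict Implicit.
Unset Printing Implicit Defensive.

(** * The join and the inclusion for n >= 2k-1 *)

Lemma models_variety e : variety (fun A => satisfies A e).
Proof.
have evalE (A B : algebra) (f : A -> B) : hom f ->
    forall v t, f (eval v t) = eval (f \o v) t.
  by move=> [fD fM] v; elim=> //= t1 <- t2 <-.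
split.
- move=> A B f hf surj Ae v.
  have [g fg] := choice surj.
  have -> : v = f \o (g \o v) by apply: funext => i /=; rewrite fg.
  by rewrite -!(evalE _ _ _ hf) Ae.
- move=> A B f _ hf inj_f Ae v; apply: inj_f.
  by rewrite !(evalE _ _ _ hf) Ae.
- move=> I F Fe v; apply: functional_extensionality_dep => i.
  have evi t : eval v t i = eval (fun x => v x i) t.
    by elim: t => //= t1 <- t2 <-.
  by rewrite !evi Fe.
Qed.

Lemma generated_variety_variety S : variety (generated_variety S).
Proof.
split.
- move=> A B f hf sf HA K vK KS; case: (vK) => h _ _.
  exact: h hf sf (HA K vK KS).
- move=> A B f iB hf sf HA K vK KS; case: (vK) => _ h _.
  exact: h iB hf sf (HA K vK KS).
- move=> I F HF K vK KS; case: (vK) => _ _; apply => i.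
  exact: HF.
Qed.

(** The models of [e] form a variety, so they include the join as soon as they include [A] and
    [B]. *)
Lemma holds_in_join A B e :
  holds_in (variety_join (generated_variety A) (generated_variety B)) e <->
  satisfies A e /\ satisfies B e.
Proof.
split=> [he|[Ae Be] C].
  by split; apply: he => K vK sA sB; [apply: sA|apply: sB] => L vL.
move=> /(_ (fun D => satisfies D e) (models_variety e)).
by apply=> D DD; apply: DD (models_variety e) _.
Qed.

Lemma join_absorb A B :
  generated_variety A B ->
  same_class (variety_join (generated_variety A) (generated_variety B))
             (generated_variety A).
Proof.
move=> AB C; split=> [jC|AC K vK sA _]; last exact: sA.
apply: jC => [|//|D BD]; first exact: generated_variety_variety.
by apply: BD => //; exact: generated_variety_variety.
Qed.

(* This identifies [Sc_power n] with {1, ..., n+1} under the maximum and the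
   addition truncated at n+1. *)
Definition enc n (x : option 'I_n) : nat := if x is Some i then i.+1 else n.+1.

Definition dec n (j : nat) : option 'I_n := insub j.-1.

Lemma enc_inj n : injective (@enc n).
Proof.
by move=> [i|] [j|] //= [] => [/val_inj->|E|E] //;
  [have := ltn_ord i|have := ltn_ord j]; rewrite ?E -?E ltnn.
Qed.

Lemma enc_gt0 n (x : option 'I_n) : 0 < enc x.
Proof. by case: x. Qed.

Lemma enc_le n (x : option 'I_n) : enc x <= n.+1.
Proof. by case: x => //= i; rewrite ltnS ltnW. Qed.

Lemma enc_eqS n (x : option 'I_n) : (enc x == n.+1) = (x == None).
Proof. by case: x => [i|] /=; rewrite ?eqxx // eqSS ltn_eqF. Qed.

Lemma enc_add n (x y : option 'I_n) :
  enc (power_add x y) = maxn (enc x) (enc y).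
Proof.
case: x y => [i|] [j|] //=; last by rewrite maxnn.
- by case: leqP => h; lia.
- by have := ltn_ord i; lia.
- by have := ltn_ord j; lia.
Qed.

Lemma encK n j : 0 < j -> enc (dec n j) = minn n.+1 j.
Proof.
by rewrite /dec; case: insubP => [i lti /= vi|] /=; lia.
Qed.

Lemma enc_mul n (x y : option 'I_n) :
  enc (power_mul x y) = minn n.+1 (enc x + enc y).
Proof.
case: x y => [i|] [j|] /=; try lia.
by case: insubP => [l lti /= vi|] /=; lia.
Qed.

(** The pairs related by [R] form an algebra. Its first projection embeds it into [A], as [R] is
    single-valued, and its second one maps onto [B]. *)
Lemma variety_hom_relation (K : class) (A B : algebra) (R : A -> B -> Prop) :
  variety K -> K A -> inhabited B ->
  (forall y, exists x, R x y) ->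
  (forall x y y', R x y -> R x y' -> y = y') ->
  (forall x y x' y', R x y -> R x' y' ->
     R (add x x') (add y y') /\ R (mul x x') (mul y y')) ->
  K B.
Proof.
move=> [homK subK _] KA [b0] surR funR morR.
pose T := {p : A * B | R p.1 p.2}.
pose op (o : forall C : algebra, C -> C -> C)
    (Ro : forall x y x' y', R x y -> R x' y' -> R (o A x x') (o B y y'))
    (p q : T) : T :=
  exist _ (o A (sval p).1 (sval q).1, o B (sval p).2 (sval q).2)
    (Ro _ _ _ _ (svalP p) (svalP q)).
pose C := Algebra (op add (fun _ _ _ _ h h' => proj1 (morR _ _ _ _ h h')))
                  (op mul (fun _ _ _ _ h h' => proj2 (morR _ _ _ _ h h'))).
have KC : K C.
  apply: (subK A C (fun p : T => (sval p).1)) => //.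
    by have [x xb0] := surR b0; constructor; exists (x, b0).
  move=> [[x y] xy] [[x' y'] xy'] /= ex; move: ex xy' => <- xy'.
  have ey := funR _ _ _ xy xy'; move: ey xy' => /= <- xy'.
  by congr exist; exact: Prop_irrelevance.
apply: (homK C B (fun p : T => (sval p).2)) => //= y.
by have [x xy] := surR y; exists (exist _ (x, y) xy).
Qed.

(* The word A is coded by the families t with t_j > n - k exactly for j in A;
   the upper bounds on t_j survive products since they are additive in #|A|. *)
Definition codes n k (t : 'I_k -> option 'I_n) (x : option (word k)) : Prop :=
  if x is Some A then
    forall j, if j \in val A then n - k < enc (t j) <= n - k + #|val A|
              else enc (t j) <= #|val A|
  else exists j, t j = None.

(** The bound on [n] enters twice: a light weight is at most [k - 1 <= n - k], so a code determines
    its word, and two heavy weights add up to at least [2 * (n - k + 1) >= n + 1], so a common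
    letter yields 0. *)
Lemma Sc_word_in_power n k : 0 < k -> 2 * k - 1 <= n ->
  generated_variety (Sc_power n) (Sc_word k).
Proof.
move=> k_gt0 le_n K vK KS; have [_ _ prodK] := vK.
have cardk (A : {set 'I_k}) : #|A| <= k by rewrite -[leqRHS]card_ord max_card.
have ltk (A : {set 'I_k}) j : j \notin A -> #|A| < k.
  move=> jA; rewrite -[ltnRHS]card_ord -cardsT; apply: proper_card.
  by rewrite properT; apply: contraNneq jA => ->; rewrite inE.
have gt0 (A : word k) : 0 < #|val A| by rewrite card_gt0 (valP A).
apply: (@variety_hom_relation K (prod_algebra (fun=> Sc_power n)) (Sc_word k)
          (@codes n k)) => //.
- by apply: prodK.
- by constructor; exact: None.
- case=> [A|]; last by exists (fun=> None), (Ordinal k_gt0).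
  exists (fun j => dec n (if j \in val A then (n - k).+1 else 1)) => j.
  have /= := gt0 A; have /= := cardk (val A); rewrite encK; last by case: ifP.
  by case: ifP => jA; rewrite ?jA; lia.
- move=> t [A|] [B|] //=.
  + move=> tA tB; congr Some; apply/val_inj/setP => j.
    have := tA j; have := tB j.
    case jB: (j \in val B); case jA: (j \in val A) => //.
      by have /= := ltk _ _ (negbT jA); lia.
    by have /= := ltk _ _ (negbT jB); lia.
  + move=> tA [j tj]; have := tA j; rewrite tj /=.
    by have /= := cardk (val A); case: ifP => [|/negbT/ltk] /=; lia.
  + move=> [j tj] tA; have := tA j; rewrite tj /=.
    by have /= := cardk (val B); case: ifP => [|/negbT/ltk] /=; lia.
- move=> t [A|] s [B|] /=.
  + move=> tA sB; split.
      move=> j; have := tA j; have := sB j; rewrite enc_add inE.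
      have /= := subset_leq_card (subsetUl (val A) (val B)).
      have /= := subset_leq_card (subsetUr (val A) (val B)).
      have /= := cardk (val A); have /= := cardk (val B).
      by case: (j \in sval A); case: (j \in sval B) => /=; lia.
    case: ifP => [dAB j|/negbT/pred0Pn[j /andP[/= jA jB]]].
      have := tA j; have := sB j; rewrite enc_mul inE /=.
      have /= := cardk (val A :|: val B).
      have -> : #|val A :|: val B| = #|val A| + #|val B|.
        by apply/eqP; rewrite (leq_card_setU _ _).2.
      have /= := disjointFr dAB (x := j).
      have /= := gt0 A; have /= := gt0 B.
      by case: (j \in sval A); case: (j \in sval B) => /=; lia.
    exists j; apply/eqP; rewrite -enc_eqS enc_mul.
    have tj := tA j; have sj := sB j; move: tj sj.
    by rewrite (jA : j \in sval A) (jB : j \in sval B); lia.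
  + move=> _ [j sj]; split; exists j; rewrite sj /power_add /power_mul;
      by case: (t j).
  + by move=> [j tj] _; split; exists j; rewrite tj.
  + by move=> [j tj] _; split; exists j; rewrite tj.
Qed.

(** * Terms as sums of monomials *)

Fixpoint monos (t : term) : seq (seq nat) :=
  match t with
  | Var i => [:: [:: i]]
  | Add t1 t2 => monos t1 ++ monos t2
  | Mul t1 t2 => [seq m1 ++ m2 | m1 <- monos t1, m2 <- monos t2]
  end.

(* The junk value at the empty word is irrelevant: members of [monos t] are
   nonempty. *)
Fixpoint mono (m : seq nat) : term :=
  match m with
  | [::] => Var 0
  | [:: i] => Var i
  | i :: m' => Mul (Var i) (mono m')
  end.

Fixpoint tsum (u : seq (seq nat)) : term :=
  match u with
  | [::] => Var 0
  | [:: m] => mono m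
  | m :: u' => Add (mono m) (tsum u')
  end.

Definition tle (q t : term) : identity := (Add q t, t).

(** Addition is the join of this order, and 0 is the greatest element of both semirings. *)
Definition le (A : algebra) (x y : A) := add x y = y.

Lemma monos_neq0 t m : m \in monos t -> m != [::].
Proof.
elim: t m => [i|t1 IH1 t2 IH2|t1 IH1 t2 IH2] m /=.
- by rewrite inE => /eqP->.
- by rewrite mem_cat => /orP[/IH1|/IH2].
- by case/allpairsP=> -[m1 m2] [/IH1 + _ ->] /=; case: m1.
Qed.

Lemma monos_nonempty t : monos t != [::].
Proof.
elim: t => //= t1 + t2; first by case: (monos t1).
by case: (monos t1) => // m1 s1 _; case: (monos t2).
Qed.

Lemma mono_cons i m : m != [::] -> mono (i :: m) = Mul (Var i) (mono m).
Proof. by case: m. Qed.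

Lemma monos_mono m : m != [::] -> monos (mono m) = [:: m].
Proof.
elim: m => // i [|j m] IH _ //.
by rewrite mono_cons // [LHS]/= IH.
Qed.

Lemma monos_tsum u : u != [::] -> all (fun m => m != [::]) u ->
  monos (tsum u) = u.
Proof.
elim: u => // m [|m' u] IH _ /andP[m0 u0]; first exact: monos_mono.
by rewrite [LHS]/= monos_mono // IH.
Qed.

(** * The order of a commutative ai-semiring and the reduction to inequalities *)

Definition comm_ai_semiring (A : algebra) := is_ai_semiring A /\ commutative (@mul A).

Section Order.
Variables (A : algebra) (csrA : comm_ai_semiring A).
Implicit Types (x y z : A) (v : nat -> A).

Lemma csr_addA : associative (@add A). Proof. by case: csrA => -[[]]. Qed.
Lemma csr_addC : commutative (@add A). Proof. by case: csrA => -[[]]. Qed.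
Lemma csr_addxx : idempotent_op (@add A). Proof. by case: csrA => -[[]]. Qed.
Lemma csr_mulA : associative (@mul A). Proof. by case: csrA => -[_ []]. Qed.
Lemma csr_mulC : commutative (@mul A). Proof. by case: csrA. Qed.
Lemma csr_mulDl : left_distributive (@mul A) (@add A).
Proof. by case: csrA => -[_ []]. Qed.
Lemma csr_mulDr : right_distributive (@mul A) (@add A).
Proof. by case: csrA => -[_ []]. Qed.

Lemma lexx x : le x x. Proof. exact: csr_addxx. Qed.

Lemma le_trans y x z : le x y -> le y z -> le x z.
Proof. by rewrite /le => xy <-; rewrite csr_addA xy. Qed.

Lemma le_add x y z : le (add x y) z <-> le x z /\ le y z.
Proof.
rewrite /le; split=> [<-|[xz yz]]; last by rewrite -csr_addA yz.
split; first by rewrite !csr_addA csr_addxx.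
by rewrite !csr_addA [add y x]csr_addC -[add (add x y) y]csr_addA csr_addxx.
Qed.

Lemma le_anti x y : le x y -> le y x -> x = y.
Proof. by rewrite /le => xy yx; rewrite -yx csr_addC xy. Qed.

Lemma eval_mono_cat v m1 m2 : m1 != [::] -> m2 != [::] ->
  eval v (mono (m1 ++ m2)) = mul (eval v (mono m1)) (eval v (mono m2)).
Proof.
move=> + m20; elim: m1 => // i [|j m1] IH _.
  by rewrite [_ ++ _]/= (mono_cons i m20).
rewrite cat_cons (mono_cons i (_ : (j :: m1) ++ m2 != [::])) // mono_cons //.
have E (p : nat) w : eval v (Mul (Var p) w) = mul (v p) (eval v w) by [].
by rewrite !E IH // csr_mulA.
Qed.

Lemma le_eval v t z :
  le (eval v t) z <-> forall m, m \in monos t -> le (eval v (mono m)) z.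
Proof.
(* The context [c] serves the induction: at a product, each factor in turn joins the context of the
   other. *)
suff E (w : term) (c : A -> A) : c = id \/ (exists x, c = mul x) ->
    le (c (eval v w)) z <->
    forall m, m \in monos w -> le (c (eval v (mono m))) z.
  by apply: (E t id); left.
elim: w c => [i|t1 IH1 t2 IH2|t1 IH1 t2 IH2] c hc.
- split=> [h m|h]; first by rewrite inE => /eqP->.
  exact: (h [:: i] (mem_head _ _)).
- have -> : c (eval v (Add t1 t2)) = add (c (eval v t1)) (c (eval v t2)).
    by case: hc => [->|[x ->]] //=; rewrite csr_mulDr.
  rewrite le_add IH1 // IH2 //=; split=> [[h1 h2] m|h].
    by rewrite mem_cat => /orP[/h1|/h2].
  by split=> m mt; apply: h; rewrite mem_cat mt ?orbT.
- have cM x y : exists d, (d = id \/ exists x, d = mul x) /\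
      forall y, c (mul x y) = d y.
    case: hc => [->|[w ->]]; first by exists (mul x); split=> //; right; exists x.
    exists (mul (mul w x)); split=> [|y']; first by right; eexists.
    by rewrite csr_mulA.
  rewrite [eval _ _]/=; have [d [hd cd]] := cM (eval v t1) z.
  rewrite cd IH2 //; split=> [h _ /allpairsP[[m1 m2] [/= m1t m2t ->]]|h m2 m2t].
    rewrite eval_mono_cat ?(monos_neq0 m1t) ?(monos_neq0 m2t) //.
    have [d' [hd' cd']] := cM (eval v (mono m2)) z.
    rewrite csr_mulC cd'; move: m1 m1t; apply/IH1 => //.
    by rewrite -cd' csr_mulC cd; exact: h.
  rewrite -cd csr_mulC; have [d' [hd' cd']] := cM (eval v (mono m2)) z.
  rewrite cd' IH1 // => m1 m1t; rewrite -cd' csr_mulC -eval_mono_cat;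
    rewrite ?(monos_neq0 m1t) ?(monos_neq0 m2t) //.
  by apply: h; apply/allpairsP; exists (m1, m2).
Qed.

Lemma le_mono v t m : m \in monos t -> le (eval v (mono m)) (eval v t).
Proof. by move: m; apply/le_eval/lexx. Qed.

End Order.

Lemma csr_Sc_power n : comm_ai_semiring (Sc_power n).
Proof.
split; first exact: Sc_power_ai_semiring.
by move=> [i|] [j|] //=; rewrite addnC.
Qed.

Lemma csr_Sc_word k : comm_ai_semiring (Sc_word k).
Proof.
split; first exact: Sc_word_ai_semiring.
move=> [u|] [v|] //=; rewrite disjoint_sym; case: ifP => // _.
by congr Some; apply: val_inj; rewrite /= setUC.
Qed.

Definition csr_axioms : seq identity :=
  let x := Var 0 in let y := Var 1 in let z := Var 2 in
  [:: (Add x (Add y z), Add (Add x y) z); (Add x y, Add y x); (Add x x, x);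
      (Mul x (Mul y z), Mul (Mul x y) z); (Mul (Add x y) z, Add (Mul x z) (Mul y z));
      (Mul x (Add y z), Add (Mul x y) (Mul x z)); (Mul x y, Mul y x)].

Definition val3 A (x y z : A) (i : nat) : A :=
  match i with 0 => x | 1 => y | _ => z end.

Lemma csr_axiomsP A :
  comm_ai_semiring A <-> forall e, List.In e csr_axioms -> satisfies A e.
Proof.
split=> [cA e|h].
  rewrite /csr_axioms /=.
  case=> [<-|[<-|[<-|[<-|[<-|[<-|[<-|[]]]]]]]] v /=; [exact: csr_addA|exact: csr_addC|
    exact: csr_addxx|exact: csr_mulA|exact: csr_mulDl|exact: csr_mulDr|
    exact: csr_mulC].
have ax i : i < 7 -> satisfies A (nth (Var 0, Var 0) csr_axioms i).
  by move=> i7; apply: h; do 7?[case: i i7 => [|i] i7] => //=; tauto.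
split; first (split; split).
- by move=> x y z; have := ax 0 isT (val3 x y z).
- by move=> x y; have := ax 1 isT (val3 x y x).
- by move=> x; have := ax 2 isT (val3 x x x).
- by move=> x y z; have := ax 3 isT (val3 x y z).
- by move=> x y z; have := ax 4 isT (val3 x y z).
- by move=> x y z; have := ax 5 isT (val3 x y z).
- by move=> x y; have := ax 6 isT (val3 x y x).
Qed.

Lemma In_cat T (x : T) s1 s2 :
  List.In x (s1 ++ s2) <-> List.In x s1 \/ List.In x s2.
Proof. by elim: s1 => //= [|y s1 ->]; tauto. Qed.

(** An identity amounts to two inequalities, and a sum is below an element exactly when all its
    monomials are. *)
Lemma finitely_based_le A B s :
  comm_ai_semiring A -> comm_ai_semiring B ->
  (forall e, List.In e s -> satisfies A e /\ satisfies B e) ->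
  (forall C, comm_ai_semiring C -> (forall e, List.In e s -> satisfies C e) ->
   forall q t, q != [::] ->
     satisfies A (tle (mono q) t) -> satisfies B (tle (mono q) t) ->
     satisfies C (tle (mono q) t)) ->
  finitely_based (variety_join (generated_variety A) (generated_variety B)).
Proof.
move=> cA cB sAB der; exists (csr_axioms ++ s); split=> [e|[t1 t2]].
  rewrite In_cat => es; apply/holds_in_join; case: es => es; last exact: sAB.
  by split; [apply: (proj1 (csr_axiomsP A))|apply: (proj1 (csr_axiomsP B))].
move/holds_in_join=> [At Bt] C Cs.
have cC : comm_ai_semiring C.
  by apply/csr_axiomsP => e es; apply: Cs; rewrite In_cat; left.
have leC w1 w2 : satisfies A (w1, w2) -> satisfies B (w1, w2) ->
    forall v : nat -> C, le (eval v w1) (eval v w2).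
  move=> Aw Bw v; apply/le_eval => // q qw.
  apply: der => //; first by move=> e es; apply: Cs; rewrite In_cat; right.
  - exact: monos_neq0 qw.
  - by move=> w; have /= <- := Aw w; exact: le_mono.
  - by move=> w; have /= <- := Bw w; exact: le_mono.
have At' : satisfies A (t2, t1) by move=> w; exact: esym (At w).
have Bt' : satisfies B (t2, t1) by move=> w; exact: esym (Bt w).
move=> v; exact: (le_anti cC (leC _ _ At Bt v) (leC _ _ At' Bt' v)).
Qed.

(** * A finite basis for the powers *)

Definition wt (y : nat -> nat) (m : seq nat) := sumn [seq y i | i <- m].

Lemma leq_wt (y y' : nat -> nat) m :
  (forall i, y i <= y' i) -> wt y m <= wt y' m.
Proof. by move=> yy'; elim: m => //= i m IH; apply: leq_add. Qed.

Lemma minn_wt n y m : minn n (wt (fun i => minn n (y i)) m) = minn n (wt y m).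
Proof. by elim: m => //= i m; rewrite /wt /=; lia. Qed.

Lemma eq_in_wt y y' m : {in m, y =1 y'} -> wt y m = wt y' m.
Proof. by move=> yy'; congr sumn; apply/eq_in_map. Qed.

Definition pow_le n (q : seq nat) (u : seq (seq nat)) : Prop :=
  forall y, (forall i, 0 < y i) ->
  exists2 m, m \in u & minn n.+1 (wt y q) <= wt y m.

Lemma enc_mono n (w : nat -> Sc_power n) m : m != [::] ->
  enc (eval w (mono m)) = minn n.+1 (wt (fun i => enc (w i)) m).
Proof.
elim: m => // i [|j m] IH _.
  by rewrite /wt /= addn0; have := enc_le (w i); lia.
rewrite mono_cons // -[LHS]/(enc (power_mul (w i) (eval w (mono (j :: m))))).
by rewrite enc_mul IH // /wt /=; lia.
Qed.

Lemma le_enc n (x y : Sc_power n) : le x y <-> enc x <= enc y.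
Proof.
rewrite /le -[add x y]/(power_add x y); split=> [<-|xy].
  by rewrite enc_add; lia.
by apply: (@enc_inj n); rewrite enc_add; lia.
Qed.

Lemma eval_attained n (w : nat -> Sc_power n) t :
  exists2 m, m \in monos t & eval w t = eval w (mono m).
Proof.
elim: t => [i|t1 [m1 m1t e1] t2 [m2 m2t e2]|t1 [m1 m1t e1] t2 [m2 m2t e2]].
- by exists [:: i]; rewrite ?inE.
- have [h|h] : add (eval w t1) (eval w t2) = eval w t1 \/
               add (eval w t1) (eval w t2) = eval w t2.
    case: (eval w t1) (eval w t2) => [a|] [b|] /=; auto.
    by case: ifP; auto.
  + by exists m1; rewrite ?mem_cat ?m1t // -e1; exact: h.
  + by exists m2; rewrite ?mem_cat ?m2t ?orbT // -e2; exact: h.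
- exists (m1 ++ m2); first by apply/allpairsP; exists (m1, m2).
  rewrite (eval_mono_cat (csr_Sc_power n)) ?(monos_neq0 m1t) ?(monos_neq0 m2t) //.
  by rewrite /= e1 e2.
Qed.

(** The order of [Sc_power n] is total, so a term takes the value of one of its monomials.
    Truncating the weights of letters does not change a truncated sum, so all positive weights may
    be allowed. *)
Lemma Sc_power_le n q t : q != [::] ->
  satisfies (Sc_power n) (tle (mono q) t) <-> pow_le n q (monos t).
Proof.
have cS := csr_Sc_power n.
move=> q0; split=> [h y y0|h w].
  pose w i : Sc_power n := dec n (y i).
  have Ew i : enc (w i) = minn n.+1 (y i) by rewrite encK.
  have wtE m : m != [::] -> enc (eval w (mono m)) = minn n.+1 (wt y m).
    move=> m0; rewrite enc_mono //.
    by under eq_in_wt => i _ do rewrite Ew; rewrite minn_wt.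
  have [m mt em] := eval_attained w t; exists m => //.
  have /le_enc : le (eval w (mono q)) (eval w t) := h w.
  by rewrite em !wtE ?(monos_neq0 mt) //; lia.
have [m mt qm] := h (fun i => enc (w i)) (fun i => enc_gt0 (w i)).
apply: (le_trans cS (y := eval w (mono m))); last exact: le_mono.
by apply/le_enc; rewrite !enc_mono ?(monos_neq0 mt) //; lia.
Qed.

Fixpoint words (T : Type) (a : seq T) (L : nat) : seq (seq T) :=
  if L is L'.+1 then [::] :: [seq x :: s | x <- a, s <- words a L']
  else [:: [::]].

Lemma mem_words (T : eqType) (a : seq T) L s :
  (s \in words a L) = (size s <= L) && all (mem a) s.
Proof.
elim: L s => [|L IH] [|x s] //=; rewrite inE /=.
apply/allpairsP/and3P => [[[z s'] /= [za + [-> ->]]]|[sL xa sa]].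
  by rewrite IH => /andP[].
by exists (x, s); rewrite IH; split=> //; apply/andP.
Qed.

Lemma finite_witnesses (S T : eqType) (l : seq S) (u : seq T) (R : S -> T -> Prop) :
  (forall y, y \in l -> exists2 m, m \in u & R y m) ->
  exists u', [/\ size u' <= size l, {subset u' <= u} &
    forall y, y \in l -> exists2 m, m \in u' & R y m].
Proof.
elim: l => [|y l IH] h; first by exists [::].
have [z zl|u' [su' uu' hu']] := IH; first by apply: h; rewrite inE zl orbT.
have [m mu ym] := h y (mem_head _ _).
exists (m :: u'); split=> // [z|z]; rewrite inE.
  by case/predU1P => [->|/uu'].
case/predU1P => [->|/hu'[m' m'u' zm']]; first by exists m; rewrite ?mem_head.
by exists m'; rewrite // inE m'u' orbT.
Qed.

Lemma In_map (T : eqType) (S : Type) (f : T -> S) s y :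
  List.In y (map f s) <-> exists2 x, x \in s & f x = y.
Proof.
elim: s => [|a s IH] /=; first by split=> // -[].
rewrite IH; split=> [[<-|[x xs <-]]|[x]]; first by exists a; rewrite ?mem_head.
  by exists x; rewrite // inE xs orbT.
by rewrite inE => /predU1P[->|xs]; [left|right; exists x].
Qed.

Lemma eval_map (A : algebra) (v : nat -> A) f m : m != [::] ->
  eval v (mono (map f m)) = eval (v \o f) (mono m).
Proof.
elim: m => // i [|j m] IH _ //.
rewrite map_cons (mono_cons (f i) (_ : map f (j :: m) != [::])) //.
by rewrite (mono_cons i (_ : j :: m != [::])) // [RHS]/= -IH.
Qed.

Lemma eq_in_eval (A : algebra) (v v' : nat -> A) m : m != [::] -> {in m, v =1 v'} ->
  eval v (mono m) = eval v' (mono m).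
Proof.
elim: m => // i [|j m] IH _ vv'; first by apply: vv'; rewrite mem_head.
rewrite (mono_cons i (_ : j :: m != [::])) // [LHS]/= [RHS]/= -/(mono (j :: m)).
rewrite vv' ?mem_head // -[eval v _]/(eval v (mono (j :: m))) IH //.
by move=> l lm; apply: vv'; rewrite inE lm orbT.
Qed.

Lemma pow_le_map n f q u :
  pow_le n q u -> pow_le n (map f q) (map (map f) u).
Proof.
have E y m : wt y (map f m) = wt (y \o f) m by rewrite /wt -map_comp.
move=> h y y0; have [m mu qm] := h (y \o f) (fun i => y0 _).
by exists (map f m); rewrite ?map_f // !E.
Qed.

(* A weight on the letters of [q], truncated at n+1 and extended by 1, decides
   one instance of [pow_le], and there are boundedly many of them. *)
Lemma pow_le_small n q u : size q <= n -> pow_le n q u ->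
  exists u', [/\ size u' <= size (words (iota 1 n.+1) n), u' != [::],
    {subset u' <= u} & pow_le n q u'].
Proof.
set l := words _ _ => qn h.
pose ext ys x := nth 1 ys (index x q).
pose R ys m := minn n.+1 (wt (ext ys) q) <= wt (ext ys) m.
have [ys ysl|u' [su' uu' hu']] := @finite_witnesses _ _ l u R.
  apply: h => i; rewrite /ext; have [lt|ge] := ltnP (index i q) (size ys).
    move: ysl; rewrite mem_words => /andP[_ /allP/(_ _ (mem_nth 1 lt)) yi].
    have : nth 1 ys (index i q) \in iota 1 n.+1 by [].
    by rewrite mem_iota => /andP[].
  by rewrite nth_default.
exists u'; split=> // [|y y0].
  (* The empty word belongs to [l] and needs a witness, so [u'] is not empty. *)
  by have [|m] := hu' [::]; [rewrite mem_words|case: (u')].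
pose ys := [seq minn n.+1 (y i) | i <- q].
have ysl : ys \in l.
  rewrite mem_words size_map qn; apply/allP => _ /mapP[i _ ->].
  rewrite -[X in is_true X]/(_ \in iota 1 n.+1) mem_iota.
  by have := y0 i; lia.
have extE i : i \in q -> ext ys i = minn n.+1 (y i).
  by move=> iq; rewrite /ext (nth_map 0) ?index_mem // nth_index.
(* The weight [ext ys] agrees with [y] on [q] up to truncation and nowhere exceeds it, so its
   witness serves for [y]. *)
have [m mu' qm] := hu' _ ysl; exists m => //.
rewrite -minn_wt -(eq_in_wt extE); apply: leq_trans qm _; apply: leq_wt => i.
have [iq|iq] := boolP (i \in q); first by rewrite extE // geq_minr.
by rewrite /ext nth_default // size_map leqNgt index_mem.
Qed.

Lemma big_monomial_top n C : 0 < n -> comm_ai_semiring C ->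
  satisfies C (tle (mono [:: n.+1]) (mono (iota 0 n.+1))) ->
  forall (v : nat -> C) (z : C) m, n < size m -> le z (eval v (mono m)).
Proof.
move=> n0 cC h v z m nm.
(* Words longer than [n.+1] are covered because variable [n] stands for the product of all letters
   from position [n] on. *)
pose v' i := if i < n then v (nth 0 m i) else
  if i == n then eval v (mono (drop n m)) else z.
have : le (v' n.+1) (eval v' (mono (iota 0 n.+1))) := h v'.
have -> : v' n.+1 = z by rewrite /v' ltnNge leqnSn /= gtn_eqF.
have -> : iota 0 n.+1 = iota 0 n ++ [:: n] by rewrite -addn1 iotaD.
rewrite eval_mono_cat // -?size_eq0 ?size_iota -?lt0n //.
have -> : eval v (mono m) =
    mul (eval v (mono (take n m))) (eval v (mono (drop n m))).
  rewrite -[in LHS](cat_take_drop n m).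
  by apply: eval_mono_cat; rewrite // -size_eq0 -lt0n ?size_drop ?subn_gt0
    ?size_takel // ltnW.
have -> : take n m = map (nth 0 m) (iota 0 n).
  by rewrite map_nth_iota0 // ltnW.
rewrite eval_map -?size_eq0 ?size_iota -?lt0n //=.
have -> : v' n = eval v (mono (drop n m)) by rewrite /v' ltnn eqxx.
congr (le z (mul _ _)); apply: eq_in_eval; rewrite -?size_eq0 ?size_iota -?lt0n //.
by move=> i; rewrite mem_iota /v' => /andP[_ ->].
Qed.

(** By [VS] only the identities of [Sc_power n] matter. The basis makes products of more than [n]
    factors greatest and lists all valid inequalities of bounded size. *)
Lemma Sc_power_finitely_based n k : 0 < n ->
  (forall e, satisfies (Sc_power n) e -> satisfies (Sc_word k) e) ->
  finitely_based (variety_join (generated_variety (Sc_power n))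
                               (generated_variety (Sc_word k))).
Proof.
move=> n0 VS.
(* [N] bounds the number of letters in [q] and in [L] further monomials, all of length at most
   [n]. *)
pose L := size (words (iota 1 n.+1) n); pose N := n + n * L.
pose W := words (iota 0 N) n.
pose idt (c : seq nat * seq (seq nat)) := tle (mono c.1) (tsum c.2).
pose cands := [seq (q, u) | q <- W, u <- words W L].
pose s := tle (mono [:: n.+1]) (mono (iota 0 n.+1)) ::
  map idt [seq c <- cands | `[< satisfies (Sc_power n) (idt c) >]].
apply: (@finitely_based_le _ _ s); [exact: csr_Sc_power|exact: csr_Sc_word|..].
  move=> e es; suff se : satisfies (Sc_power n) e by split=> //; apply: VS.
  case: es => [<-|/In_map[c + <-]]; last by rewrite mem_filter => /andP[/asboolP].
  rewrite Sc_power_le // => y y0; exists (iota 0 n.+1).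
    by rewrite monos_mono ?mem_head // -size_eq0 size_iota.
  apply: leq_trans (geq_minl _ _) _; rewrite -{1}(size_iota 0 n.+1).
  elim: (iota _ _) => //= i m IH; rewrite -add1n leq_add //; exact: y0.
move=> C cC Cs q t q0 /(Sc_power_le _ _ q0) qt _ v.
have top m (z : C) : n < size m -> le z (eval v (mono m)).
  by move=> nm; apply: (big_monomial_top n0 cC) => //; apply: Cs; left.
have [/hasP[m mt nm]|/hasPn small] := boolP (has (fun m => n < size m) (monos t)).
  exact: (le_trans cC (top _ _ nm) (le_mono cC v mt)).
have wt1 m : wt (fun=> 1) m = size m by elim: m => //= i m; rewrite /wt /= => ->.
(* With all weights equal to 1 the inequality compares lengths. *)
have qn : size q <= n.
  have [//|m mt] := qt (fun=> 1); rewrite !wt1 => /leq_trans/(_ (_ : _ <= n)).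
  by rewrite geq_min ltnn; apply; rewrite leqNgt small.
have [u' [su' u'0 u't qu']] := pow_le_small qn qt.
have u'ne m : m \in u' -> m != [::] by move=> /u't/monos_neq0.
(* Replacing variables by their positions in this list turns the inequality into a member of
   [cands]. *)
pose vars := q ++ flatten u'; pose rho x := index x vars.
have rhoK x : x \in vars -> nth 0 vars (rho x) = x by exact: nth_index.
have varsq : {subset q <= vars} by move=> x xq; rewrite mem_cat xq.
have varsu m : m \in u' -> {subset m <= vars}.
  by move=> mu' x xm; rewrite mem_cat; apply/orP; right; apply/flattenP; exists m.
have svars : size vars <= N.
  rewrite size_cat leq_add // size_flatten.
  apply: leq_trans (_ : n * size u' <= _); last by rewrite leq_mul2l su' orbT.
  have : forall m, m \in u' -> size m <= n.
    by move=> m /u't/small; rewrite -leqNgt.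
  elim: (u') => //= m u IH h; rewrite mulnS leq_add ?h ?mem_head ?IH // => m' m'u.
  by apply: h; rewrite inE m'u orbT.
have rhoN x : x \in vars -> rho x \in iota 0 N.
  by rewrite mem_iota /= -index_mem => h; apply: leq_trans svars.
have monW m : size m <= n -> {subset m <= vars} -> map rho m \in W.
  move=> mn mv; rewrite mem_words size_map mn; apply/allP => _ /mapP[x xm ->].
  exact/rhoN/mv.
pose c := (map rho q, map (map rho) u').
have u'm : monos (tsum c.2) = c.2.
  rewrite monos_tsum // -?size_eq0 ?size_map ?size_eq0 //.
  by apply/allP => _ /mapP[m /u'ne + ->]; rewrite -!size_eq0 size_map.
have Sc : satisfies (Sc_power n) (idt c).
  rewrite Sc_power_le ?u'm; first exact: pow_le_map.
  by rewrite -size_eq0 size_map size_eq0.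
have Cc : satisfies C (idt c).
  apply: Cs; right; apply/In_map; exists c => //.
  rewrite mem_filter; apply/andP; split; first exact/asboolP.
  apply/allpairsP; exists c; split=> //; first exact: monW.
  rewrite mem_words size_map su'; apply/allP => _ /mapP[m mu' ->] /=.
  by apply: monW; [rewrite leqNgt small ?u't|exact: varsu].
pose v' i := v (nth 0 vars i).
have Ev m : m != [::] -> {subset m <= vars} ->
    eval v' (mono (map rho m)) = eval v (mono m).
  move=> m0 mv; rewrite eval_map //; apply: eq_in_eval => // x /mv xv.
  by rewrite /v' /= rhoK.
rewrite -[_ = _]/(le (eval v (mono q)) (eval v t)) -Ev //.
apply: (le_trans cC (Cc v')); apply/le_eval => //; rewrite u'm.
move=> _ /mapP[m mu' ->]; rewrite Ev ?u'ne //; last exact: varsu.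
by apply: le_mono => //; exact: u't.
Qed.

(** * Graph algebras *)

Section GraphAlgebra.
Variables (V : finType) (e : rel V).

Definition gword := {A : {set V} | A != set0}.

Lemma gword_union_neq0 (u v : gword) : val u :|: val v != set0.
Proof. by rewrite setU_eq0 negb_and (valP u). Qed.

Definition gword_union (u v : gword) : gword :=
  exist _ (val u :|: val v) (gword_union_neq0 u v).

Definition gadd (x y : option gword) : option gword :=
  match x, y with
  | Some u, Some v => Some (gword_union u v)
  | _, _ => None
  end.

Definition compat (x y : option gword) : bool :=
  match x, y with
  | Some u, Some v => [forall a in val u, forall b in val v, e a b]
  | _, _ => false
  end.

Definition gmul (x y : option gword) : option gword :=
  if compat x y then gadd x y else None.

(* For the complete graph on k vertices this is S_c^*(a_1 ... a_k). *)
Definition graph_algebra : algebra :=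
  {| carrier := option gword; add := gadd; mul := gmul |}.

Fixpoint vars (t : term) : seq nat :=
  match t with
  | Var i => [:: i]
  | Add t1 t2 | Mul t1 t2 => vars t1 ++ vars t2
  end.

Lemma mem_vars i t : (i \in vars t) = has (fun m => i \in m) (monos t).
Proof.
elim: t => [j|t1 IH1 t2 IH2|t1 IH1 t2 IH2] /=; first by rewrite orbF.
  by rewrite mem_cat has_cat IH1 IH2.
rewrite mem_cat IH1 IH2; apply/orP/hasP => [[|] /hasP[m mt im]|[m]].
- have [m' m't] : exists m', m' \in monos t2.
    by case: (monos t2) (monos_nonempty t2) => // m' s _; exists m'; apply: mem_head.
  by exists (m ++ m'); rewrite ?mem_cat ?im //; apply/allpairsP; exists (m, m').
- have [m' m't] : exists m', m' \in monos t1.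
    by case: (monos t1) (monos_nonempty t1) => // m' s _; exists m'; apply: mem_head.
  by exists (m' ++ m); rewrite ?mem_cat ?im ?orbT //; apply/allpairsP; exists (m', m).
- case/allpairsP=> -[m1 m2] [/= m1t m2t ->]; rewrite mem_cat => /orP[]im;
    [left|right]; apply/hasP; by [exists m1|exists m2].
Qed.

Definition supp (x : option gword) : {set V} := if x is Some u then val u else set0.

Implicit Types (v : nat -> graph_algebra) (f : nat -> option V).

(** Positions are compared, so a repeated variable has to be compatible with itself, which an
    irreflexive [e] forbids. *)
Definition nonzero v (m : seq nat) :=
  all (fun i => v i != None :> option gword) m &&
  pairwise (fun i j => compat (v i) (v j)) m.

Lemma gaddP (x y : option gword) :
  (gadd x y != None) = (x != None) && (y != None).
Proof. by case: x y => [u|] [w|]. Qed.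

Lemma supp_gadd (x y : option gword) : gadd x y != None ->
  supp (gadd x y) = supp x :|: supp y.
Proof. by case: x y => [u|] [w|]. Qed.

Lemma gmul_neq0 (x y : option gword) :
  (gmul x y != None) = compat x y.
Proof. by rewrite /gmul; case: ifP => //; case: x y => [u|] [w|]. Qed.

Lemma compatP (x y : option gword) :
  reflect [/\ x != None, y != None & forall a b, a \in supp x -> b \in supp y -> e a b]
          (compat x y).
Proof.
case: x y => [u|] [w|] /=; try by constructor; case.
apply: (iffP forall_inP) => [h|[_ _ h] a au].
  by split=> // a b /h/forall_inP; apply.
by apply/forall_inP => b; apply: h.
Qed.

Lemma supp_eval v t : eval v t != None :> option gword -> forall a,
  a \in supp (eval v t) <-> exists2 i, i \in vars t & a \in supp (v i).
Proof.
have aux t1 t2 a : (exists2 i, i \in vars t1 ++ vars t2 & a \in supp (v i)) <->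
    (exists2 i, i \in vars t1 & a \in supp (v i)) \/
    (exists2 i, i \in vars t2 & a \in supp (v i)).
  split=> [[i]|[|] [i it ai]]; first rewrite mem_cat => /orP[]it ai.
  - by left; exists i.
  - by right; exists i.
  - by exists i; rewrite // mem_cat it.
  - by exists i; rewrite // mem_cat it orbT.
elim: t => [i|t1 IH1 t2 IH2|t1 IH1 t2 IH2] /=.
- move=> _ a; split=> [|[j]]; first by exists i; rewrite ?inE.
  by rewrite inE => /eqP->.
- rewrite gaddP => /andP[n1 n2] a.
  by rewrite supp_gadd ?gaddP ?n1 // inE aux -IH1 // -IH2 //; split=> /orP.
- rewrite gmul_neq0 => c a; case/compatP: (c) => n1 n2 _.
  by rewrite /gmul c supp_gadd ?gaddP ?n1 // inE aux -IH1 // -IH2 //; split=> /orP.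
Qed.

(** The letters of a nonzero value are those of its variables, so two factors are compatible exactly
    when any variables of theirs are, and these meet in some concatenated monomial. *)
Lemma eval_neq0 v t : (eval v t != None :> option gword) = all (nonzero v) (monos t).
Proof.
elim: t => [i|t1 IH1 t2 IH2|t1 IH1 t2 IH2].
- by rewrite /= /nonzero /= !andbT.
- by rewrite /= gaddP all_cat IH1 IH2.
rewrite /= gmul_neq0; apply/compatP/all_allpairsP => /=.
  move=> [n1 n2 h] m1 m2 m1t m2t.
  have /allP/(_ _ m1t)/andP[a1 p1] : all (nonzero v) (monos t1) by rewrite -IH1.
  have /allP/(_ _ m2t)/andP[a2 p2] : all (nonzero v) (monos t2) by rewrite -IH2.
  rewrite /nonzero all_cat pairwise_cat a1 a2 p1 p2 !andbT /=.
  apply/allrelP => i j im jm; apply/compatP; split; try by [apply: (allP a1)|apply: (allP a2)].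
  move=> a b av bv; apply: h; apply/supp_eval => //.
    by exists i; rewrite // mem_vars; apply/hasP; exists m1.
  by exists j; rewrite // mem_vars; apply/hasP; exists m2.
move=> h.
have h' m1 m2 : m1 \in monos t1 -> m2 \in monos t2 ->
    [/\ nonzero v m1, nonzero v m2 & allrel (fun i j => compat (v i) (v j)) m1 m2].
  move=> m1t m2t; have := h _ _ m1t m2t.
  rewrite /nonzero all_cat pairwise_cat => /andP[/andP[-> ->]].
  by case/and3P => -> -> ->.
have n1 : eval v t1 != None :> option gword.
  rewrite IH1; apply/allP => m1 m1t.
  case: (monos t2) (monos_nonempty t2) h' => // m2 s _ /(_ _ _ m1t (mem_head _ _)).
  by case.
have n2 : eval v t2 != None :> option gword.
  rewrite IH2; apply/allP => m2 m2t.
  case: (monos t1) (monos_nonempty t1) h' => // m1 s _ /(_ _ _ (mem_head _ _) m2t).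
  by case.
split=> // a b /supp_eval-/(_ n1)[i + ai] /supp_eval-/(_ n2)[j + bj].
rewrite !mem_vars => /hasP[m1 m1t im] /hasP[m2 m2t jm].
have [_ _ /allrelP/(_ _ _ im jm)/compatP[_ _]] := h' _ _ m1t m2t.
exact.
Qed.

Definition oadj (x y : option V) := if (x, y) is (Some a, Some b) then e a b else false.

Definition clique f (m : seq nat) := all (fun i => isSome (f i)) m &&
  pairwise (fun i j => oadj (f i) (f j)) m.

Lemma clique_pair f i j : clique f [:: i; j] = oadj (f i) (f j).
Proof. by rewrite /clique /= !andbT; case: (f i) (f j) => [a|] [b|]. Qed.

(** For the complete graph these [f] are the proper colourings of the graph joining variables that
    share a monomial, a repeated variable being a loop. *)
Definition cliques f (t : term) := all (clique f) (monos t).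

Lemma cliques_vars f t i : cliques f t -> i \in vars t -> isSome (f i).
Proof.
rewrite mem_vars => /allP h /hasP[m /h/andP[/allP fm _]]; exact: fm.
Qed.

Hypothesis e_irr : irreflexive e.

Lemma pairwiseN (T : eqType) (r : rel T) m : ~~ pairwise r m ->
  exists i j, subseq [:: i; j] m /\ ~~ r i j.
Proof.
elim: m => //= i m IH; rewrite negb_and => /orP[/allPn[j jm nij]|/IH].
  by exists i, j; rewrite eqxx sub1seq.
move=> [j [l [jlm njl]]]; exists j, l; split=> //.
exact: subseq_trans jlm (subseq_cons _ _).
Qed.

Lemma not_cliqueP f m : ~~ clique f m ->
  (exists2 i, i \in m & f i = None) \/
  exists i j a b, [/\ subseq [:: i; j] m, f i = Some a, f j = Some b & ~~ e a b].
Proof.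
rewrite negb_and; have [/allP sm|nsm] := boolP (all (fun i => isSome (f i)) m); last first.
  by case/allPn: nsm => i im p; left; exists i => //; case: (f i) p.
move=> /pairwiseN[i [j [ijm nij]]]; right; exists i, j.
have : isSome (f i) by apply/sm/(mem_subseq ijm); rewrite !inE eqxx.
have : isSome (f j) by apply/sm/(mem_subseq ijm); rewrite !inE eqxx orbT.
move: nij; case: (f i) (f j) => [a|] [b|] // nab _ _.
by exists a, b.
Qed.

Lemma clique_subseq f m m' : subseq m' m -> clique f m -> clique f m'.
Proof.
move=> m'm /andP[/allP am pm]; rewrite /clique (subseq_pairwise m'm pm) andbT.
by apply/allP => i /(mem_subseq m'm)/am.
Qed.

Lemma set1_neq0 (a : V) : [set a] != set0.
Proof. by rewrite -card_gt0 cards1. Qed.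

Definition gsingle (a : V) : gword := exist _ [set a] (set1_neq0 a).

Lemma clique_single f m :
  nonzero (fun i => omap gsingle (f i)) m = clique f m.
Proof.
congr (_ && _); first by apply: eq_all => i /=; case: (f i).
apply: eq_pairwise => i j /=; case: (f i) (f j) => [a|] [b|] //=.
apply/forall_inP/idP => [/(_ a (set11 a))/forall_inP/(_ b (set11 b))//|eab].
by move=> _ /set1P->; apply/forall_inP => _ /set1P->.
Qed.

(* A choice of one letter in each nonzero value, following [f] if possible. *)
Definition pick_letter v f i : option V :=
  if v i is Some u then
    if [pick a in val u | f i == Some a] is Some a then Some a
    else [pick a in val u]
  else None.

Lemma pick_letterP v f i : v i != None :> option gword ->
  exists2 a, a \in supp (v i) & pick_letter v f i = Some a.
Proof.
rewrite /pick_letter; case: (v i) => //= u _.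
case: pickP => [a /andP[au _]|_]; first by exists a.
case: pickP => [a au|u0]; first by exists a.
by case/set0Pn: (valP u) => a; rewrite u0.
Qed.

Lemma pick_letterE v f i u a : v i = Some u -> a \in val u -> f i = Some a ->
  pick_letter v f i = Some a.
Proof.
rewrite /pick_letter => -> au ->; case: pickP => [a' /andP[_ /eqP[->]]|] //.
by move=> /(_ a); rewrite au eqxx.
Qed.

Lemma cliques_pick v f t :
  eval v t != None :> option gword -> cliques (pick_letter v f) t.
Proof.
rewrite eval_neq0 => n1; apply/allP => m1 m1t.
have /allP/(_ _ m1t)/andP[/allP a1 p1] := n1.
apply/andP; split; first by apply/allP => i /a1/(pick_letterP f)[a _ ->].
move: p1; apply: sub_pairwise => i j /compatP[].
by move=> /(pick_letterP f)[a ai ->] /(pick_letterP f)[b bj ->]; apply.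
Qed.

(* A zero product is witnessed by one letter from each of two factors. *)
Lemma cliques_le v t1 t2 :
  (forall f, cliques f t1 -> cliques f t2) ->
  eval v t1 != None :> option gword -> eval v t2 != None :> option gword.
Proof.
move=> h n1; rewrite eval_neq0; apply: contraT => /allPn[m mt nm].
have clm f : clique (pick_letter v f) m.
  by apply: (allP (h _ (cliques_pick f n1))).
have v_neq0 i : i \in m -> v i != None :> option gword.
  move=> im; have /andP[/allP/(_ i im) + _] := clm (fun=> None).
  by rewrite /pick_letter; case: (v i).
case/nandP: nm => [/allPn[i /v_neq0->]//|/pairwiseN[i [j [ijm]]]].
have [im jm] : i \in m /\ j \in m.
  by split; apply: (mem_subseq ijm); rewrite !inE eqxx ?orbT.
case vi: (v i) (v_neq0 i im) => [x|] // _.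
case vj: (v j) (v_neq0 j jm) => [y|] // _ /=.
case/forall_inPn => a ax /forall_inPn[b bY nab].
pose f l := if l == i then Some a else Some b.
have := clique_subseq ijm (clm f); rewrite /clique /= !andbT => /andP[_].
have fi : f i = Some a by rewrite /f eqxx.
(* If [i = j], one letter is chosen for both positions, and irreflexivity gives the
   contradiction. *)
rewrite (pick_letterE vi ax fi); have [eji|nji] := eqVneq j i.
  by rewrite eji (pick_letterE vi ax fi) /oadj e_irr.
have fj : f j = Some b by rewrite /f (negPf nji).
by rewrite (pick_letterE vj bY fj) /oadj (negPf nab).
Qed.

Lemma eq_in_cliques f f' t : {in vars t, f =1 f'} -> cliques f t = cliques f' t.
Proof.
move=> ff'; apply: eq_in_all => m mt.
have fE : {in m, f =1 f'}.
  by move=> j jm; apply: ff'; rewrite mem_vars; apply/hasP; exists m.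
congr (_ && _); first by apply: eq_in_all => j /fE->.
by apply: (@eq_in_pairwise _ (mem m)); [move=> j l /fE-> /fE->|apply/allP].
Qed.

(** Sending a variable of [t1] missing from [t2] to 0 would annihilate [t1] only. *)
Lemma cliques_sub_vars f t1 t2 :
  (forall f', cliques f' t2 -> cliques f' t1) ->
  cliques f t2 -> {subset vars t1 <= vars t2}.
Proof.
move=> h f2 i it1; apply: contraT => it2.
pose f' j := if j == i then None else f j.
suff /h/cliques_vars/(_ it1) : cliques f' t2 by rewrite /f' eqxx.
rewrite -(eq_in_cliques (f := f)) // => j jt2.
by rewrite /f'; case: eqP => // ji; rewrite -ji jt2 in it2.
Qed.

(** Valuations by single letters decide whether a value is 0. A nonzero value is the union of those
    of the variables, and both sides have the same variables once one of them can be nonzero. *)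
Theorem graph_satisfies t1 t2 :
  satisfies graph_algebra (t1, t2) <-> forall f, cliques f t1 = cliques f t2.
Proof.
split=> [h f|h v].
  pose v i : graph_algebra := omap gsingle (f i).
  have E t : cliques f t = (eval v t != None :> option gword).
    by rewrite eval_neq0; apply: eq_all => m; rewrite clique_single.
  by rewrite !E (h v).
have h12 f : cliques f t1 -> cliques f t2 by rewrite h.
have h21 f : cliques f t2 -> cliques f t1 by rewrite h.
have le12 := cliques_le (v := v) h12; have le21 := cliques_le (v := v) h21.
have [n1|/negPn/eqP e1] := boolP (eval v t1 != None :> option gword); last first.
  rewrite [LHS]e1; apply/esym/eqP; apply: contraT => /le21.
  by rewrite [X in X != None]e1.
have n2 := le12 n1.
have s12 := cliques_sub_vars h21 (cliques_pick (fun=> None) n2).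
have s21 := cliques_sub_vars h12 (cliques_pick (fun=> None) n1).
have : supp (eval v t1) = supp (eval v t2).
  apply/setP => a; apply/idP/idP => /supp_eval-/(_ ltac:(assumption))[i it ai];
    by apply/supp_eval => //; exists i => //; auto.
rewrite /=; case: (eval v t1) (eval v t2) n1 n2 => [u|] [w|] //= _ _ uw.
by congr Some; apply: val_inj.
Qed.

End GraphAlgebra.

Lemma Sc_word_graph k (e : identity) :
  satisfies (Sc_word k) e <->
  satisfies (graph_algebra (fun i j : 'I_k => i != j)) e.
Proof.
pose G := graph_algebra (fun i j : 'I_k => i != j).
have addE (x y : option (word k)) : word_add x y = @add G x y.
  by case: x y => [u|] [w|] //=; congr Some; apply: val_inj.
have mulE (x y : option (word k)) : word_mul x y = @mul G x y.
  case: x y => [u|] [w|] //=; rewrite /gmul /=.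
  rewrite (_ : [disjoint _ & _] =
    [forall a in val u, forall b in val w, a != b]).
    by case: ifP => // _; congr Some; apply: val_inj.
  apply/pred0P/forall_inP => [h a au|h a /=].
    apply/forall_inP => b bw; apply: contraTneq bw => <-.
    by have := h a; rewrite /= au /= => /negbT.
  apply/negbTE/negP => /andP[au aw].
  by have /forall_inP/(_ a aw) := h a au; rewrite eqxx.
have E (v : nat -> option (word k)) t : @eval (Sc_word k) v t = @eval G v t.
  by elim: t => //= t1 -> t2 ->; [exact: addE|exact: mulE].
by split=> h v; have := h v; rewrite !E.
Qed.

(** * Two letters *)

Lemma Sc_word_satisfies k t1 t2 :
  satisfies (Sc_word k) (t1, t2) <->
  forall f, cliques (fun i j : 'I_k => i != j) f t1 =
            cliques (fun i j : 'I_k => i != j) f t2.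
Proof.
by rewrite Sc_word_graph; apply: graph_satisfies => i; rewrite eqxx.
Qed.

Lemma Sc_word_le k q t : q != [::] ->
  satisfies (Sc_word k) (tle (mono q) t) <->
  forall f, cliques (fun i j : 'I_k => i != j) f t ->
            clique (fun i j : 'I_k => i != j) f q.
Proof.
move=> q0; rewrite Sc_word_satisfies; set e := fun i j => _.
have E f : cliques e f (Add (mono q) t) = clique e f q && cliques e f t.
  by rewrite /cliques /= monos_mono.
by split=> h f; [rewrite -h E => /andP[]|rewrite E andb_idl //; exact: h].
Qed.

(** In a proper 2-colouring the ends of a walk of three edges differ in colour. *)
Definition path_rule : identity :=
  tle (mono [:: 0; 3]) (tsum [:: [:: 0; 1]; [:: 1; 2]; [:: 2; 3]]).

Definition factor_rule : identity := tle (mono [:: 0]) (mono [:: 0; 1]).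

Definition cube_rule : identity := tle (mono [:: 3]) (mono (iota 0 3)).

(** A square is 0, hence greatest, in [Sc_word 2] and in [Sc_power 1]. In [Sc_power 2] it may be
    nonzero, and variable 1 needs a neighbour. *)
Definition loop_rule n : identity :=
  if n == 1 then tle (mono [:: 1]) (mono [:: 0; 0])
  else tle (mono [:: 0; 1]) (tsum [:: [:: 0; 0]; [:: 1; 2]]).

Definition two_rules n := [:: path_rule; factor_rule; cube_rule; loop_rule n].

Lemma Sc_power_two_rules n r : 0 < n <= 2 -> List.In r (two_rules n) ->
  satisfies (Sc_power n) r.
Proof.
move=> n12 [<-|[<-|[<-|[<-|//]]]]; rewrite ?/loop_rule;
  try (case: eqP => n1); rewrite Sc_power_le //= => y y_gt0;
  have := (y_gt0 0, y_gt0 1, (y_gt0 2, y_gt0 3)) => -[[y0 y1] [y2 y3]].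
- have [y01|y01] := ltnP 1 (y 0); first by exists [:: 0; 1]; rewrite // /wt /=; lia.
  have [y31|y31] := ltnP 1 (y 3); first by exists [:: 2; 3]; rewrite // /wt /=; lia.
  by exists [:: 0; 1]; rewrite // /wt /=; lia.
- by exists [:: 0; 1]; rewrite // /wt /=; lia.
- by exists [:: 0; 1; 2]; rewrite // /wt /=; lia.
- by exists [:: 0; 0]; rewrite // /wt /=; lia.
- have [y11|y11] := ltnP 1 (y 1); first by exists [:: 1; 2]; rewrite // /wt /=; lia.
  by exists [:: 0; 0]; rewrite // /wt /=; lia.
Qed.

Lemma Sc_word_two_rules n r : List.In r (two_rules n) -> satisfies (Sc_word 2) r.
Proof.
case=> [<-|[<-|[<-|[<-|//]]]]; rewrite ?/loop_rule;
  try (case: eqP => n1); rewrite Sc_word_le // => f;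
  rewrite /cliques /clique /= /oadj;
  move: (f 0) (f 1) (f 2) (f 3) => [[[|[|//]] ?]|] [[[|[|//]] ?]|]
    [[[|[|//]] ?]|] [[[|[|//]] ?]|] //=.
Qed.

Section TwoColors.
Variables (n : nat) (C : algebra).
Hypotheses (n12 : 0 < n <= 2) (cC : comm_ai_semiring C).
Hypothesis rulesC : forall r, List.In r (two_rules n) -> satisfies C r.

Let val4 (a b c d : C) (i : nat) : C :=
  match i with 0 => a | 1 => b | 2 => c | _ => d end.

Lemma path_ruleE (a b c d z : C) :
  le (mul a b) z -> le (mul b c) z -> le (mul c d) z -> le (mul a d) z.
Proof.
move=> ab bc cd; have r : satisfies C path_rule by apply: rulesC; left.
apply: (le_trans cC (r (val4 a b c d))).
by apply/(le_add cC); split=> //; apply/(le_add cC).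
Qed.

Lemma factor_ruleE (a b : C) : le a (mul a b).
Proof.
have r : satisfies C factor_rule by apply: rulesC; right; left.
exact: (r (val4 a b a a)).
Qed.

Lemma loop_rule1E (a b : C) : n = 1 -> le b (mul a a).
Proof.
move=> n1; have := rulesC (or_intror (or_intror (or_intror (or_introl erefl)))).
by rewrite /loop_rule n1 => /(_ (val4 a b a a)).
Qed.

Lemma loop_rule2E (a b c z : C) : n = 2 ->
  le (mul a a) z -> le (mul b c) z -> le (mul a b) z.
Proof.
move=> n2 aa bc.
have := rulesC (or_intror (or_intror (or_intror (or_introl erefl)))).
rewrite /loop_rule n2 => /(_ (val4 a b c c)) r; apply: (le_trans cC r).
exact/(le_add cC).
Qed.

Variables (v : nat -> C) (t : term).
Hypothesis small : forall m, m \in monos t -> size m <= 2.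

(* [D] and [E] connect vertices joined by odd and by even walks, respectively: the
   path rule makes [D] closed under composition of three edges. *)
Let U := eval v t.
Let D i j := le (mul (v i) (v j)) U.
Let E i j := i = j \/ exists2 l, D i l & D l j.

Let Dsym i j : D i j -> D j i. Proof. by rewrite /D (csr_mulC cC). Qed.

Let D3 i j l p : D i j -> D j l -> D l p -> D i p.
Proof. exact: path_ruleE. Qed.

Let ED i j l : E i j -> D j l -> D i l.
Proof. by case=> [->//|[p ip pj]] jl; apply: D3 ip pj jl. Qed.

Let DD i j l : D i j -> D j l -> E i l.
Proof. by move=> ij jl; right; exists j. Qed.

Lemma le_letter i : i \in vars t -> le (v i) U.
Proof.
rewrite mem_vars => /hasP[m mt im].
have := le_mono cC v mt; move: (small mt) im; case: m {mt} => [|a [|b []]] //= _.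
  by rewrite inE => /eqP->.
rewrite !inE => /orP[] /eqP-> h; apply: (le_trans cC _ h).
  exact: factor_ruleE.
by rewrite (csr_mulC cC); exact: factor_ruleE.
Qed.

Lemma edge_le i j : [:: i; j] \in monos t -> D i j.
Proof. exact: le_mono. Qed.

Section NoLoop.
Hypothesis noloop : forall i, ~ D i i.

Let joined r i := `[< E r i \/ D r i >].
Let root l i := nth 0 l (find (joined^~ i) l).

(* Each vertex is coloured by the parity of its distance to the first vertex of
   [l] in its component. *)
Let coloring l i : option 'I_2 :=
  Some (if `[< E (root l i) i >] then ord0 else ord_max).

Let e2 := fun i j : 'I_2 => i != j.

Lemma coloring_edge l i j : D i j -> i \in l ->
  coloring l i != coloring l j.
Proof.
move=> ij il.
have rij : root l i = root l j.
  congr (nth 0 l _); apply: eq_find => r.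
  apply/asboolP/asboolP => -[ri|ri].
  - by right; apply: ED ri ij.
  - by left; apply: DD ri ij.
  - by right; apply: ED ri (Dsym ij).
  - by left; apply: DD ri (Dsym ij).
have : joined (root l i) i.
  by apply: (@nth_find _ 0 (joined^~ i) l); apply/hasP; exists i => //; apply/asboolP; left; left.
rewrite /coloring -rij; set r := root l i => /asboolP Jri.
case: asboolP => ri; case: asboolP => rj //.
  (* Even walks from [r] to both ends of an edge form an odd closed walk, which the path rule
     contracts to a loop at [r]. *)
  case: (noloop (i := r)); have rDj := ED ri ij.
  by case: rj => [rj|[p rp pj]]; [rewrite {2}rj|apply: D3 rDj (Dsym pj) (Dsym rp)].
by case: Jri => // ri'; case: rj; apply: DD ri' ij.
Qed.

Lemma coloring_cliques l : {subset vars t <= l} -> cliques e2 (coloring l) t.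
Proof.
move=> tl; apply/allP => m mt; have := small mt; have := edge_le.
have : forall i, i \in m -> i \in l.
  by move=> i im; apply: tl; rewrite mem_vars; apply/hasP; exists m.
move: mt; case: m => [|a [|b []]] //= mt ml /(_ a b mt) ab _.
rewrite /clique /= !andbT; have := coloring_edge ab (ml a (mem_head _ _)).
by [].
Qed.

Lemma coloring_head l i : coloring (i :: l) i = Some ord0.
Proof.
rewrite /coloring /root /=; have -> : joined i i by apply/asboolP; left; left.
by rewrite /=; case: asboolP => // -[]; left.
Qed.

(** With [i] and [j] listed first, [j] is its own root unless its root is [i], and then the walk
    between them is even. *)
Lemma coloring_head2 l i j : ~ D i j -> coloring (i :: j :: l) j = Some ord0.
Proof.
move=> nij; rewrite /coloring /root /=; case ij: (joined i j).
  have {}ij : E i j by move/asboolP: ij => [].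
  by rewrite /=; case: asboolP.
have -> : joined j j by apply/asboolP; left; left.
by rewrite /=; case: asboolP => // -[]; left.
Qed.

(** A proper 2-colouring of [t] exists, so [q] has only variables of [t] and length at most two. A
    pair outside [D] could be coloured alike. *)
Lemma noloop_complete q : q != [::] ->
  (forall f, cliques e2 f t -> clique e2 f q) -> le (eval v (mono q)) U.
Proof.
move=> q0 h.
have qt : {subset q <= vars t}.
  have := @cliques_sub_vars _ e2 (coloring (vars t)) (mono q) t.
  have -> : vars (mono q) = q.
    by elim: (q) q0 => // i [|j m] IH _ //; rewrite mono_cons //= -IH.
  apply; last exact: coloring_cliques.
  by move=> f ft; rewrite /cliques monos_mono //= h.
case: q q0 h qt => [|i [|j q]] // _ h qt; first exact/le_letter/qt/mem_head.
have ht l : {subset vars t <= l} -> clique e2 (coloring l) [:: i, j & q].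
  by move=> /coloring_cliques/h.
case: q h qt ht => [|l q] h qt ht.
  apply: contrapT => nij.
  have : clique e2 (coloring [:: i, j & vars t]) [:: i; j].
    by apply: ht => p pt; rewrite !inE pt !orbT.
  by rewrite /clique /= coloring_head coloring_head2.
have := ht (vars t) (fun _ => id); rewrite /clique /=.
case/andP=> _ /andP[/and3P[+ + _] /andP[/andP[+ _] _]].
by rewrite /oadj /coloring; do 3!case: ifP => _.
Qed.

End NoLoop.

Lemma loop_complete q l : q != [::] -> D l l ->
  pow_le n q (monos t) -> le (eval v (mono q)) U.
Proof.
move=> q0 ll qt; case: (n =P 1) => [n1|n1].
  by apply: (le_trans cC _ ll); exact: loop_rule1E.
have n2 : n = 2 by lia.
rewrite n2 in qt.
have wt1 m : wt (fun=> 1) m = size m by elim: m => //= i m; rewrite /wt /= => ->.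
(* One heavy variable among weights 1 forces it into the witness: monomials of [t] without it weigh
   at most 2. *)
have heavy i c : 1 < c ->
    exists2 m, m \in monos t & minn 3 (wt (fun j => if j == i then c else 1) q) <=
    (if i \in m then wt (fun j => if j == i then c else 1) m else size m).
  move=> c1; have [j|m mt qm] := qt (fun j => if j == i then c else 1).
    by case: ifP => // _; apply: ltnW.
  exists m => //; case: ifP => // im.
  rewrite -wt1 -(eq_in_wt (y := fun j => if j == i then c else 1)) //.
  by move=> j jm; case: eqP => // ji; rewrite -ji jm in im.
have q2 : size q <= 2.
  have [//|m /small m2] := qt (fun=> 1); rewrite !wt1 => /leq_trans/(_ m2).
  by rewrite geq_min.
case: q q0 qt heavy q2 => [|i [|j []]] // _ qt heavy _.
  have [m mt] := heavy i 3 isT; rewrite /wt /= eqxx addn0.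
  case: ifP => [im _|_ /leq_trans/(_ (small mt))] //.
  by apply: le_letter; rewrite mem_vars; apply/hasP; exists m.
have nbr p : p \in [:: i; j] -> exists c, D p c.
  move=> pij.
  have w3 : minn 3 (wt (fun j => if j == p then 2 else 1) [:: i; j]) = 3.
    by move: pij; rewrite /wt /= !inE => /orP[]/eqP->; rewrite eqxx; case: ifP.
  have [m mt] := heavy p 2 isT; rewrite w3.
  case: ifP => [pm|_]; last by move=> /leq_trans/(_ (small mt)).
  move: mt pm (small mt); case: m => [|a [|b []]] //= mt.
    by rewrite inE /wt /= => /eqP->; rewrite eqxx.
  rewrite !inE => /orP[]/eqP-> _ _; first by exists b; exact: edge_le.
  by exists a; exact/Dsym/edge_le.
have [[c ic] [d jd]] := (nbr i (mem_head _ _), nbr j (mem_last i [:: j])).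
(* The loop rule joins [i] and [j] to [l], and the walk [i, l, l, j] has three edges. *)
by apply: (D3 (Dsym (loop_rule2E n2 ll ic)) ll (loop_rule2E n2 ll jd)).
Qed.

End TwoColors.

Lemma Sc_word2_finitely_based n : 0 < n <= 2 ->
  finitely_based (variety_join (generated_variety (Sc_power n))
                               (generated_variety (Sc_word 2))).
Proof.
move=> n12; apply: (@finitely_based_le _ _ (two_rules n)).
- exact: csr_Sc_power.
- exact: csr_Sc_word.
- by move=> r rn; split; [apply: Sc_power_two_rules rn|apply: Sc_word_two_rules rn].
move=> C cC rulesC q t q0 /(Sc_power_le _ _ q0) Pq /(Sc_word_le _ _ q0) Wq v.
rewrite -[_ = _]/(le (eval v (mono q)) (eval v t)).
have [/hasP[m mt nm]|/hasPn small] := boolP (has (fun m => 2 < size m) (monos t)).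
  apply: (le_trans cC _ (le_mono cC v mt)); apply: (big_monomial_top (n := 2)) => //.
  by apply: rulesC; right; right; left.
have {}small m : m \in monos t -> size m <= 2 by move=> /small; rewrite -leqNgt.
have [[l ll]|noloop] := pselect (exists l, le (mul (v l) (v l)) (eval v t)).
  exact: (loop_complete n12 cC rulesC small q0 ll Pq).
apply: (noloop_complete cC rulesC small _ q0 Wq) => i ii.
by apply: noloop; exists i.
Qed.

(** * Nonfinitely based joins *)

(** A failure of the identity in the graph algebra involves at most [M] letters and two nonadjacent
    ones. Colouring these two alike carries the failure over to [Sc_word k]. *)
Lemma graph_satisfies_small (V : finType) (e : rel V) k M t1 t2 :
  irreflexive e ->
  (forall l : seq V, size l <= M -> forall a b, ~~ e a b ->
     exists2 c : V -> 'I_k,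
       {in l &, forall x y, e x y -> c x != c y} & c a = c b) ->
  size (vars t1 ++ vars t2) <= M ->
  satisfies (Sc_word k) (t1, t2) -> satisfies (graph_algebra e) (t1, t2).
Proof.
move=> e_irr good; rewrite size_cat => sM /Sc_word_satisfies kE.
set ek := fun i j : 'I_k => _ in kE.
suff le s1 s2 : size (vars s1) <= M ->
    (forall f, cliques ek f s1 -> cliques ek f s2) ->
    forall f, cliques e f s1 -> cliques e f s2.
  apply/graph_satisfies => // f; apply/idP/idP; apply: le => [|f'];
    rewrite ?kE //; lia.
move=> s1M kle f f1; apply: contraT => /allPn[m mt nm].
pose l := pmap f (vars s1).
have lM : size l <= M by apply: leq_trans s1M; rewrite size_pmap count_size.
have push (c : V -> 'I_k) : {in l &, forall x y, e x y -> c x != c y} ->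
    clique ek (fun i => omap c (f i)) m.
  move=> cl; suff /kle/allP/(_ _ mt) : cliques ek (fun i => omap c (f i)) s1 by [].
  apply/allP => m1 m1t; have /andP[a1 p1] := allP f1 _ m1t; apply/andP; split.
    by apply: sub_all a1 => i; case: (f i).
  move: p1; have m1m1 : all (mem m1) m1 by apply/allP.
  apply: (sub_in_pairwise _ m1m1).
  have ml i a : i \in m1 -> f i = Some a -> a \in l.
    move=> im fi; rewrite mem_pmap -fi map_f // mem_vars.
    by apply/hasP; exists m1.
  move=> i j im jm; rewrite /oadj; case fi: (f i) => [a|] //.
  by case fj: (f j) => [b|] //=; apply: cl; [exact: (ml i)|exact: (ml j)].
case/not_cliqueP: nm => [[i im fi]|[i [j [a [b [ijm fi fj nab]]]]]].
  have [m1 m1t] : exists m1, m1 \in monos s1.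
    by case: (monos s1) (monos_nonempty s1) => // m' s _; exists m'; apply: mem_head.
  have [a _] : exists a : V, True.
    have /andP[/allP m1f _] := allP f1 _ m1t.
    case: m1 m1t m1f (monos_neq0 m1t) => // j m1 _ /(_ j (mem_head _ _)) + _.
    by case: (f j) => // a; exists a.
  (* Only some local colouring is needed here, and [a] is not adjacent to itself. *)
  have [|c cl _] := good l lM a a; first by rewrite e_irr.
  by have /andP[/allP/(_ _ im)] := push c cl; rewrite fi.
have [c cl cab] := good l lM a b nab.
have := clique_subseq ijm (push c cl).
by rewrite /clique /= fi fj /oadj /= cab /ek eqxx.
Qed.

(** * Shift graphs *)

Section ShiftGraph.
Variable N : nat.
Implicit Types x y z : seq 'I_N.

Definition increasing x := sorted (fun i j : 'I_N => i < j) x.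

(** The directed shift graph of Erdős and Hajnal: the first entry is dropped and a larger last one
    appended. *)
Definition shift x y :=
  if x is a :: z then (y == rcons z (last a y)) && increasing (a :: y) else false.

Lemma shiftP x y : reflect
  (exists a z b, [/\ x = a :: z, y = rcons z b & increasing (a :: rcons z b)])
  (shift x y).
Proof.
apply: (iffP idP) => [|[a [z [b [-> -> inc]]]]]; last first.
  by rewrite /shift last_rcons eqxx.
case: x => //= a z /andP[/eqP yE inc].
by exists a, z, (last a y); rewrite -yE.
Qed.

Lemma increasing_uniq x : increasing x -> uniq x.
Proof.
apply: sorted_uniq => [i j l|i]; [exact: ltn_trans|exact: ltnn].
Qed.

(* If [c] colours the increasing (s+2)-sequences, the set of colours of the
   extensions of an increasing (s+1)-sequence is a proper colouring of these. *)
Lemma shift_colors s (C : finType) (c : seq 'I_N -> C) :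
  (forall a z b, size z = s -> increasing (a :: rcons z b) ->
     c (a :: z) != c (rcons z b)) ->
  N <= iter s (expn 2) #|C|.
Proof.
elim: s C c => [|s IH] C c h.
  have inj_c : injective (fun i => c [:: i]).
    have lt (i j : 'I_N) : i < j -> c [:: i] != c [:: j].
      by move=> ij; apply: (h i [::] j) => //; rewrite /increasing /= ij.
    move=> i j /eqP cij; apply/val_inj/eqP; case: ltngtP => // /lt.
      by rewrite cij.
    by rewrite eq_sym cij.
  by rewrite -[leqLHS](card_ord N); exact: leq_card inj_c.
pose c' z : {set C} := [set c (rcons z b) | b : 'I_N & increasing (rcons z b)].
rewrite iterSr -cardsT -card_powerset powersetT cardsT.
apply: (IH _ c') => a z b sz inc.
(* If this colour also lay in the other set, some neighbour [z b b'] of [a z b] would share it. *)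
apply/eqP => e; have : c (rcons (a :: z) b) \in c' (a :: z).
  by apply/imsetP; exists b; rewrite ?inE.
rewrite e => /imsetP[b']; rewrite inE => inc' /eqP; apply/negP.
rewrite rcons_cons; apply: h; first by rewrite size_rcons sz.
move: inc inc'; rewrite /increasing /= => inc.
rewrite rcons_path inc /= last_rcons.
case: (z) => [|d z'] /=; first by rewrite andbT.
by rewrite !rcons_path last_rcons => /andP[].
Qed.

Definition adj x y := shift x y || shift y x.

Lemma adj_sym : symmetric adj. Proof. by move=> x y; rewrite /adj orbC. Qed.

Lemma shift_sorted x y : shift x y -> increasing x /\ increasing y.
Proof.
move=> /shiftP[a [z [b [-> -> inc]]]]; split.
  by move: inc; rewrite /increasing /= rcons_path => /andP[].
exact: path_sorted inc.
Qed.

Lemma adj_increasing x y : adj x y -> increasing x.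
Proof. by case/orP => /shift_sorted[]. Qed.

Lemma shift_index x y t : shift x y -> t \in x -> t \in y ->
  index t x = (index t y).+1.
Proof.
move=> /shiftP[a [z [b [-> -> inc]]]]; have := increasing_uniq inc.
rewrite /= mem_rcons inE negb_or rcons_uniq => /andP[/andP[ab az] /andP[bz _]].
rewrite inE => /orP[/eqP->|tz].
  by rewrite mem_rcons inE (negPf ab) (negPf az).
move=> _; rewrite -cats1 index_cat tz; case: eqP => // at'.
by rewrite at' tz in az.
Qed.

Lemma shift_memr x y t : shift x y -> t \in x -> 0 < index t x -> t \in y.
Proof.
move=> /shiftP[a [z [b [-> -> _]]]]; rewrite inE /= mem_rcons inE.
by case: eqP => [->|_ /= -> _]; rewrite ?eqxx // orbT.
Qed.

Lemma shift_meml x y t : shift x y -> t \in y -> index t y < (size y).-1 ->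
  t \in x.
Proof.
move=> /shiftP[a [z [b [-> -> _]]]]; rewrite size_rcons /= -cats1 index_cat => _.
by case: ifP => [tz _|_]; [rewrite inE tz orbT|rewrite ltnNge leq_addr].
Qed.

Lemma adj_irr : irreflexive adj.
Proof.
move=> x; rewrite /adj orbb; apply/negP => xx.
have /shiftP[a [z [b [xE _ _]]]] := xx.
have ax : a \in x by rewrite xE mem_head.
by have /eqP := shift_index xx ax ax; rewrite ltn_eqF.
Qed.

Lemma adj_step S x y t : size x = S -> size y = S -> adj x y ->
  t \in x -> 0 < index t x -> (index t x).+1 < S ->
  t \in y /\ (index t x = (index t y).+1 \/ index t y = (index t x).+1).
Proof.
move=> sx sy /orP[xy|yx] tx i0 iS.
  have ty := shift_memr xy tx i0.
  by split=> //; left; apply: shift_index.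
have ty : t \in y by apply: (shift_meml yx) => //; rewrite sx; lia.
by split=> //; right; apply: shift_index.
Qed.

(** An edge moves a letter by one place and can lose it only at an end of the sequence. *)
Lemma adj_path S (x : S.-tuple 'I_N) (p : seq (S.-tuple 'I_N)) t :
  path (fun x y : S.-tuple 'I_N => adj x y) x p -> t \in x ->
  size p <= index t x -> index t x + size p < S -> t \in last x p.
Proof.
elim: p x => //= y p IH x /andP[xy yp] tx pi iS.
have [||ty iy] := adj_step (size_tuple x) (size_tuple y) xy tx; try lia.
by apply: IH => //; lia.
Qed.

(* A letter in the middle of one sequence of a component of a small set of
   sequences stays present throughout the component, and its position changes by
   one along each edge. *)
Lemma shift_locally_bipartite M (l : seq (M.*2.+1.-tuple 'I_N)) :
  size l <= M -> exists g : M.*2.+1.-tuple 'I_N -> bool,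
  {in l &, forall x y : M.*2.+1.-tuple 'I_N, adj x y -> g x != g y}.
Proof.
move=> lM; set T := _.-tuple _.
pose r (x y : T) := [&& x \in l, y \in l & adj x y].
have r_sym : connect_sym r.
  by apply: sym_connect_sym => x y; rewrite /r adj_sym andbCA.
pose mid (x : T) := tnth (root r x) (inord M).
exists (fun x : T => odd (index (mid x) x)).
have mem_mid (x y : T) : x \in l -> y \in l -> adj x y -> mid x \in x.
  move=> xl yl xy; rewrite /mid; set z := root r x.
  have : connect r z x by rewrite r_sym connect_root.
  case/connectP => p0 /shortenP[p rp up _] {p0} xE.
  have pl : {subset p <= l}.
    move: rp; clear; elim: p z => //= y p IH z /andP[/and3P[_ yl _] yp] w.
    by rewrite inE => /predU1P[->//|]; apply: IH yp _.
  have pM : size p <= M.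
    by apply: leq_trans lM; apply: uniq_leq_size pl; case/andP: up.
  (* The root lies on an edge, namely the first one of the path or the one from [x] to [y], so it is
     increasing. *)
  have uz : uniq z.
    apply: increasing_uniq; case: (p) rp xE => [_ /= <-|w p' /= /andP[/and3P[_ _ zw] _] _].
      exact: adj_increasing xy.
    exact: adj_increasing zw.
  have Mz : M < size z by rewrite size_tuple; lia.
  have iz : index (tnth z (inord M)) z = M.
    rewrite (tnth_nth (tnth z (inord M))) inordK; last lia.
    exact: index_uniq.
  rewrite xE; apply: adj_path.
  - by apply: sub_path rp => a b /and3P[].
  - exact: mem_tnth.
  - by rewrite iz.
  - by rewrite iz ltnS; apply: leq_trans (leq_add (leqnn M) pM) _; rewrite addnn.
move=> x y xl yl xy /=.
have rxy : root r x = root r y.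
  by apply/eqP; rewrite root_connect //; apply: connect1; rewrite /r xl yl.
have mxy : mid x = mid y by rewrite /mid rxy.
have mx := mem_mid x y xl yl xy.
have my : mid y \in y by apply: (mem_mid y x) => //; rewrite adj_sym.
rewrite -mxy in my *.
by case/orP: xy => /shift_index->; rewrite //= ?negb_eqb ?addNb ?addbN ?addbb.
Qed.

End ShiftGraph.

(** * Disjoint union with a complete graph *)

Section CliqueSum.
Variables (V : finType) (e : rel V) (k : nat).
Hypotheses (k3 : 2 < k) (e_irr : irreflexive e) (e_sym : symmetric e).

Definition add_clique (x y : V + 'I_k) : bool :=
  match x, y with
  | inl x, inl y => e x y
  | inr i, inr j => i != j
  | _, _ => false
  end.

Lemma add_clique_irr : irreflexive add_clique.
Proof. by move=> [x|i] /=; rewrite ?e_irr ?eqxx. Qed.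

(* Only three colours allow an arbitrary nonadjacent pair to be coloured alike. *)
Lemma add_clique_local M :
  (forall l : seq V, size l <= M ->
     exists g : V -> bool, {in l &, forall x y, e x y -> g x != g y}) ->
  forall l : seq (V + 'I_k), size l <= M -> forall a b, ~~ add_clique a b ->
     exists2 c : V + 'I_k -> 'I_k,
       {in l &, forall x y, add_clique x y -> c x != c y} & c a = c b.
Proof.
move=> bip l lM.
have [g gP] : exists g : V -> bool, forall x y,
    inl x \in l -> inl y \in l -> e x y -> g x != g y.
  pose l' := pmap (fun z : V + 'I_k => if z is inl x then Some x else None) l.
  have [|g gP] := bip l'; first by rewrite size_pmap (leq_trans (count_size _ _)).
  exists g => x y xl yl; apply: gP; rewrite mem_pmap; apply/mapP.
    by exists (inl x).
  by exists (inl y).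
pose c0 : 'I_k := Ordinal (ltn_trans (isT : 0 < 2) k3).
pose c1 : 'I_k := Ordinal (ltn_trans (isT : 1 < 2) k3).
pose c2 : 'I_k := Ordinal k3.
have h a b : ~~ e a b -> exists2 h : V -> 'I_k, forall x y,
    inl x \in l -> inl y \in l -> e x y -> h x != h y & h a = h b.
  move=> nab.
  (* The third colour goes to [a] and [b] alone. *)
  exists (fun x => if (x == a) || (x == b) then c2 else if g x then c0 else c1).
    move=> x y xl yl xy; have := gP x y xl yl xy.
    have [|xn] /= := boolP ((x == a) || (x == b)).
      have [|yn _ _] := boolP ((y == a) || (y == b)); last by case: (g y).
      have nba : ~~ e b a by rewrite e_sym.
      case/orP=> /eqP ye; case/orP => /eqP xe;
        by rewrite xe ye ?e_irr ?(negPf nab) ?(negPf nba) in xy.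
    by case: ((y == a) || (y == b)); case: (g x); case: (g y).
  by rewrite !eqxx orbT.
move=> [a|i] [b|j] /= nab.
- have [h' hP hab] := h a b nab; exists (fun x => if x is inl x then h' x else
    if x is inr i then i else c0) => // -[x|i] [y|j] //=; exact: hP.
- have [h' hP _] := h a a (negbT (e_irr a)).
  (* No edge joins the two parts, so the colours of one may be permuted. *)
  exists (fun x => match x with inl x => tperm (h' a) j (h' x) | inr i => i end).
    by move=> [x|i] [y|i'] //= xl yl xy; rewrite (inj_eq perm_inj) hP.
  by rewrite tpermL.
- have [h' hP _] := h b b (negbT (e_irr b)).
  exists (fun x => match x with inl x => tperm (h' b) i (h' x) | inr i => i end).
    by move=> [x|i'] [y|i''] //= xl yl xy; rewrite (inj_eq perm_inj) hP.
  by rewrite tpermL.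
- exists (fun x => match x with inl x => if g x then c0 else c1 | inr i => i end).
    by move=> [x|i'] [y|i''] //= xl yl /(gP _ _ xl yl); case: (g x); case: (g y).
  by apply/eqP/negPn.
Qed.

End CliqueSum.

Lemma wt_mem y i m : (forall j, 0 < y j) -> i \in m ->
  y i + (size m).-1 <= wt y m.
Proof.
move=> y0; have sz s : size s <= wt y s.
  by elim: s => //= j s IH; rewrite /wt /= -add1n leq_add ?y0.
elim: m => //= j m IH; rewrite inE /wt /= => /predU1P[->|im].
  by rewrite leq_add2l sz.
have := IH im; have := y0 j; rewrite /wt; case: (m) im => //= l s _; lia.
Qed.

Lemma not_finitely_based n k : 2 < k -> n <= 2 * k - 2 ->
  ~ finitely_based (variety_join (generated_variety (Sc_power n))
                                 (generated_variety (Sc_word k))).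
Proof.
move=> k3 nk [s [hs basis]].
have [M sM] : exists M, forall d, List.In d s ->
    size (vars d.1 ++ vars d.2) <= M.
  elim: (s) => [|d s' [M IH]]; first by exists 0.
  exists (maxn (size (vars d.1 ++ vars d.2)) M) => d' [<-|/IH]; rewrite leq_max ?leqnn //.
  by move=> ->; rewrite orbT.
(* [N] exceeds the bound of [shift_colors] for [k.+1] colours, where [None] counts as a colour. *)
pose S := M.*2; pose N := (iter S (expn 2) k.+1).+1.
pose V := (S.+1.-tuple 'I_N); pose e (x y : V) := adj x y.
have e_irr : irreflexive e by move=> x; apply: adj_irr.
have e_sym : symmetric e by move=> x y; apply: adj_sym.
pose W := (V + 'I_k)%type; pose cd (x : W) : nat := pickle x.
pose q0 := cd (inr (Ordinal (ltn_trans (isT : 0 < 2) k3))).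
pose K := [seq cd (inr i) | i <- enum 'I_k].
pose edges := [seq [:: cd (inl p.1); cd (inl p.2)] | p <- enum {: V * V} & e p.1 p.2].
pose u := K :: edges.
have um : monos (tsum u) = u.
  rewrite monos_tsum //; apply/allP => m; rewrite inE => /predU1P[->|/mapP[p _ ->] //].
  by rewrite -size_eq0 size_map size_enum_ord; lia.
have Kq0 : q0 \in K by apply: map_f; rewrite mem_enum.
have edge_u (x y : V) : e x y -> [:: cd (inl x); cd (inl y)] \in u.
  move=> xy; rewrite inE; apply/orP; right; apply/mapP; exists (x, y) => //.
  by rewrite mem_filter xy mem_enum.
have bad : holds_in (variety_join (generated_variety (Sc_power n))
    (generated_variety (Sc_word k))) (tle (mono [:: q0; q0]) (tsum u)).
  apply/holds_in_join; split.
    apply/Sc_power_le => // y y0; rewrite um; exists K; first exact: mem_head.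
    (* If [y q0 <= k - 1], then [2 * y q0 <= y q0 + (k - 1)]. Otherwise [K] weighs at least
       [2 * k - 1 >= n + 1]. *)
    have := wt_mem y0 Kq0; rewrite size_map size_enum_ord /wt /=; lia.
  (* A nonzero value of the sum would colour the shift graph with too few colours. *)
  apply/Sc_word_le => // f /allP; rewrite um => fu; exfalso.
  pose c z : option 'I_k := if insub z is Some x then f (cd (inl (x : V))) else None.
  suff : N <= iter S (expn 2) #|{: option 'I_k}| by rewrite card_option card_ord ltnn.
  have cE x (sx : size x == S.+1) : c x = f (cd (inl (Tuple sx : V))).
    by rewrite /c (insubT (fun x : seq 'I_N => size x == S.+1) sx).
  apply: (shift_colors (c := c)) => a z b sz inc.
  have s1 : size (a :: z) == S.+1 by rewrite /= sz.
  have s2 : size (rcons z b) == S.+1 by rewrite size_rcons sz.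
  rewrite (cE _ s1) (cE _ s2).
  have /edge_u/fu : e (Tuple s1) (Tuple s2).
    by apply/orP; left; apply/shiftP; exists a, z, b.
  rewrite /clique /= !andbT => /andP[_]; rewrite /oadj.
  by case: (f _) => // i; case: (f _).
have Gs d : List.In d s -> satisfies (graph_algebra (@add_clique V e k)) d.
  case: d => t1 t2 ds; have /holds_in_join[_ kd] := hs _ ds.
  apply: (@graph_satisfies_small _ _ k M) kd; first exact: add_clique_irr.
    by apply: add_clique_local => // l lM; apply: shift_locally_bipartite.
  exact: sM ds.
have := basis _ bad _ Gs.
(* Under [unpickle] each variable becomes its own vertex: the sum is nonzero, the square of [q0] is
   0. *)
move/(graph_satisfies (add_clique_irr (k := k) e_irr) _ _)/(_ unpickle).
have cdK (x : W) : unpickle (cd x) = Some x by exact: pickleK.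
have -> : cliques (add_clique e (k:=k)) unpickle (tsum u).
  rewrite /cliques um; apply/allP => m; rewrite inE => /predU1P[->|].
    rewrite /clique all_map pairwise_map; apply/andP; split.
      by apply/allP => i _ /=; rewrite cdK.
    have := enum_uniq 'I_k; rewrite uniq_pairwise; apply: sub_pairwise => i j /=.
    by rewrite !cdK.
  case/mapP=> p; rewrite mem_filter => /andP[pe _] ->.
  by rewrite clique_pair !cdK /oadj /= pe.
by rewrite /cliques /= /clique /= /q0 !cdK.
Qed.

Theorem theorem8p4 (n k : nat) (hn : 1 <= n) (hk : 1 <= k) :
  (finitely_based
     (variety_join (generated_variety (Sc_power n))
                   (generated_variety (Sc_word k)))
   <-> (k <= 2 \/ 2 * k - 1 <= n)) /\
  (2 * k - 1 <= n ->
   same_class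
     (variety_join (generated_variety (Sc_power n))
                   (generated_variety (Sc_word k)))
     (generated_variety (Sc_power n))).
Proof.
have Vnk : 2 * k - 1 <= n -> generated_variety (Sc_power n) (Sc_word k).
  exact: Sc_word_in_power.
split; last by move=> /Vnk h; exact: join_absorb.
split=> [fb|nk].
  have [le_n|lt_n] := leqP (2 * k - 1) n; first by right.
  have [k2|k3] := leqP k 2; first by left.
  by exfalso; apply: (not_finitely_based k3 _ fb); lia.
have [le_n|lt_n] := leqP (2 * k - 1) n.
  apply: Sc_power_finitely_based => // e; exact: (Vnk le_n _ (models_variety e)).
(* For [k = 1] the bound [2 * k - 1 <= n] would hold. *)
have k2 : k = 2 by lia.
by rewrite k2; apply: Sc_word2_finitely_based; lia.
Qed.
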